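(* Let $r\in[1,\infty)$. The mapping $$\Phi:\left(\mathrm{Diff}_{-\infty}(\mathbb R),F\right)\to\left(W^{\infty,1}(\mathbb R),L^r\right),\qquad \varphi\mapsto r\left(\varphi_x^{1/r}-1\right)$$ is an isometric embedding. Furthermore, its image $\mathcal U=\Phi(\mathrm{Diff}_{-\infty}(\mathbb R))$ is $$\mathcal U=\{f\in W^{\infty,1}(\mathbb R): f>-r\},$$ and the inverse of $\Phi$ is given by $$\Phi^{-1}:\mathcal U\to\mathrm{Diff}_{-\infty}(\mathbb R),\qquad f\mapsto\left(x\mapsto x+\int_{-\infty}^x\left(\left(\frac{f(\tilde x)}{r}+1\right)^r-1\right)d\tilde x\right).$$
   Context: $W^{\infty,1}(\mathbb R)=\bigcap_{k\ge 0}W^{k,1}(\mathbb R)$. The group $\mathrm{Diff}_{-\infty}(\mathbb R)=\{\varphi=\mathrm{id}+f: f'\in W^{\infty,1}(\mathbb R),\ f'>-1,\ \lim_{x\to-\infty}f(x)=0\}$ is a Fréchet Lie group with Lie algebra $\mathfrak g_{-\infty}=\{u: u'\in W^{\infty,1}(\mathbb R),\ \lim_{x\to-\infty}u(x)=0\}$. Tangent vectors at $\varphi$ are of the form $h=X\circ\varphi$ with $X\in\mathfrak g_{-\infty}$, and the right-invariant Finsler metric $F$ is $$F_\varphi(h)=\left(\int_{\mathbb R}|(h\circ\varphi^{-1})'|^r\,dx\right)^{1/r}=\left(\int_{\mathbb R}|X'|^r\,dx\right)^{1/r}.$$ The vector space $W^{\infty,1}(\mathbb R)$ carries the (footpoint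 independent) Finsler metric given by the $L^r$-norm. ''Isometric'' means that the differential of $\Phi$ preserves the Finsler norms: $\|D_{\varphi,h}\Phi\|_{L^r}=F_\varphi(h)$ for all $\varphi$ and all tangent vectors $h$ at $\varphi$, where $D_{\varphi,h}\Phi$ is the derivative of $\Phi$ at $\varphi$ in direction $h$. *)

(* Defs.v *)
From HB Require Import structures.
From mathcomp Require Import all_boot all_order all_algebra.
From mathcomp Require Import all_classical all_reals all_analysis.

Set Implicit Arguments.
Unset Strict Implicit.
Unset Printing Implicit Defensive.

Import Order.TTheory GRing.Theory Num.Theory.
Import numFieldNormedType.Exports.

Local Open Scope ring_scope.
Local Open Scope classical_set_scope.

(** Differential calculus between Fréchet spaces.

A Fréchet space is given by the set [vect] of its vectors inside an ambient
vector space [E] and by an increasing sequence of seminorms; the values of the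
seminorms outside [vect] are irrelevant. *)

Record frechetData (R : realType) (E : lmodType R) := FrechetData {
  vect : set E;
  snorm : nat -> E -> R
}.

(* The balls of the single seminorms form a neighbourhood base because the
   sequence of seminorms is increasing. *)
Definition frechet_open (R : realType) (E : lmodType R) (V : frechetData E)
    (A : set E) : Prop :=
  A `<=` vect V /\
  forall x, A x -> exists n, exists2 e : R, 0 < e &
    forall h, vect V h -> snorm V n h < e -> A (x + h).

(* [f] has derivative [v] at [x] in direction [h], the limit being taken in
   the topology of [W]. *)
Definition is_dirderive (R : realType) (E F : lmodType R) (W : frechetData F)
    (f : E -> F) (x h : E) (v : F) : Prop :=
  forall m,
    snorm W m (t^-1 *: (f (x + t *: h) - f x) - v) @[t --> (0 : R)^'] --> (0 : R).

(* [D x [:: h_n; ...; h_1]] is the [n]-th derivative of [f] at [x] in the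
   directions [h_1, ..., h_n]; all these derivatives have to exist and to be
   jointly continuous in [x] and in the directions. *)
Definition frechet_smooth (R : realType) (E F : lmodType R)
    (V : frechetData E) (W : frechetData F) (A : set E) (f : E -> F) : Prop :=
  frechet_open V A /\
  exists D : E -> seq E -> F,
    [/\ forall x, A x -> D x [::] = f x,
        forall x hs, A x -> (forall i, (i < size hs)%N -> vect V hs`_i) ->
          vect W (D x hs),
        forall x h hs, A x -> vect V h ->
          (forall i, (i < size hs)%N -> vect V hs`_i) ->
          is_dirderive W (D ^~ hs) x h (D x (h :: hs))
      & forall x hs, A x -> (forall i, (i < size hs)%N -> vect V hs`_i) ->
          forall m (e : R), 0 < e -> exists n, exists2 d : R, 0 < d &
            forall y ks, A y -> size ks = size hs ->
              (forall i, (i < size hs)%N -> vect V ks`_i) ->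
              snorm V n (y - x) < d ->
              (forall i, (i < size hs)%N -> snorm V n (ks`_i - hs`_i) < d) ->
              snorm W m (D y ks - D x hs) < e].

(* Embedding of an open subset [A] of [V] as an open submanifold of [W]: a
   smooth injection whose image is open and whose inverse is smooth on it. *)
Definition frechet_open_embedding (R : realType) (E F : lmodType R)
    (V : frechetData E) (W : frechetData F) (A : set E) (f : E -> F) : Prop :=
  frechet_smooth V W A f /\
  exists2 g : F -> E, (forall x, A x -> g (f x) = x) &
    frechet_smooth W V (f @` A) g.

Section Sobolev.
Context {R : realType}.
Implicit Types (f g u h : R -> R) (phi : R -> R).

Local Notation mu := (@lebesgue_measure R).

Definition test_function (eta : R -> R) : Prop :=
  (forall n x, derivable eta^`(n) x 1) /\
  exists M : R, forall x, M < `|x| -> eta x = 0.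

Definition integrable_fun f : Prop := mu.-integrable setT (EFin \o f).

Definition is_weak_derivn (j : nat) f g : Prop :=
  forall eta, test_function eta ->
    \int[mu]_x (f x * derive1n j eta x) = (-1) ^+ j * \int[mu]_x (g x * eta x).

(* The Sobolev space W^{k,1}(R). *)
Definition sobolev (k : nat) f : Prop :=
  integrable_fun f /\
  forall j, (j <= k)%N -> exists2 g, integrable_fun g & is_weak_derivn j f g.

(* Weak derivatives are unique only up to null sets: [weak_derivn j f] is some
   representative, which is enough to compute norms. *)
Definition weak_derivn (j : nat) f : R -> R :=
  xget (cst 0) [set g | integrable_fun g /\ is_weak_derivn j f g].

Definition sobolev_norm (k : nat) f : R :=
  \sum_(j < k.+1) \int[mu]_x `|weak_derivn j f x|.

(* W^{oo,1}(R). Elements of Sobolev spaces are classes modulo null sets; the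
   classes lying in all the W^{k,1}(R) have exactly one continuous
   representative, which is the one chosen here. *)
Definition Winf1 : set (R -> R) :=
  [set f : R -> R | continuous f /\ forall k, sobolev k f].

Definition g_minf : set (R -> R) :=
  [set u : R -> R | [/\ forall x, derivable u x 1, Winf1 u^`() & u x @[x --> -oo] --> 0]].

(* The functions [f] such that [id + f] is in Diff_{-oo}(R). *)
Definition diff_chart : set (R -> R) :=
  [set f : R -> R | g_minf f /\ forall x, -1 < derive1 f x].

Definition diff_minf : set (R -> R) :=
  [set phi | exists2 f, diff_chart f & phi = (fun x => x + f x)].

(* The codomain [R^o] makes the functions a vector space over [R]. *)
Definition Winf1_frechet : frechetData (R -> R^o) :=
  @FrechetData R (R -> R^o) Winf1 sobolev_norm.

Definition g_minf_frechet : frechetData (R -> R^o) :=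
  @FrechetData R (R -> R^o) g_minf (fun k u => sobolev_norm k u^`()).

Definition tangent phi : set (R -> R) :=
  [set h | exists2 X, g_minf X & h = X \o phi].

Definition Lr_norm (r : R) f : \bar R := ('N[mu]_(r%:E)[EFin \o f])%E.

(* [pinv setT phi] is the inverse of the bijection [phi]. *)
Definition finsler (r : R) phi h : \bar R :=
  Lr_norm r (h \o pinv setT phi)^`().

Definition Phi (r : R) phi : R -> R :=
  fun x => r * ((derive1 phi x) `^ r^-1 - 1).

Definition Phi_inv (r : R) f : R -> R :=
  fun x => x + \int[mu]_(t in `]-oo, x]) ((f t / r + 1) `^ r - 1).

(* The differential at [phi], on tangent vectors of the form [X \o phi],
   preserves the norms. *)
Definition isometric (r : R) : Prop :=
  forall phi h, diff_minf phi -> tangent phi h ->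
    exists v : R -> R,
      [/\ Winf1 v,
          @is_dirderive R (R -> R^o) (R -> R^o) Winf1_frechet (Phi r) phi h v
        & Lr_norm r v = finsler r phi h].

End Sobolev.

(* Main.v *)
Require Import Defs.
From mathcomp Require Import all_boot all_order all_algebra.
From mathcomp Require Import all_classical all_reals all_analysis.
From mathcomp Require Import measurable_realfun ring lra.
Set Implicit Arguments.
Unset Strict Implicit.
Unset Printing Implicit Defensive.
Import Order.TTheory GRing.Theory Num.Theory.
Import numFieldNormedType.Exports.
Local Open Scope ring_scope.
Local Open Scope classical_set_scope.

(** In terms of [u = derive1 f], the map [Phi] is the superposition operator
    [u |-> alpha \o u] with [alpha s = r ((1 + s)^(1/r) - 1)], and its inverse is
    [w |-> beta \o w] with [beta s = (s/r + 1)^r - 1], followed by the primitive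
    vanishing at -oo.  Differentiation is a linear isometry between the two
    model spaces, so everything reduces to showing that superposition with a
    smooth function vanishing at [0] is smooth on the open set of the [u] in
    [Winf1] with [u > - c].  Testing against smoothed indicator functions
    identifies [Winf1] with the smooth functions all of whose derivatives are
    integrable.  As [|u|] is bounded by the L^1 norm of [derive1 u], these form
    an algebra, and induction on the order of the seminorm gives Lipschitz
    bounds for superposition and first order bounds for its difference
    quotients.  The isometry property is a change of variables along [phi]. *)

(** * Derivatives and the L^1 norm *)

Section Calculus.
Context {R : realType}.
Implicit Types (f g u v : R -> R).
Local Notation mu := (@lebesgue_measure R).

(** The root and power functions are smooth only on an open half-line [s > - c], and their
    derivatives may blow up at its end. A function of the class with values above [- c] nevertheless
    keeps a positive distance from [- c]: it tends to [0] at infinity and attains its minimum on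
    compact intervals. So it and its small perturbations range in one compact interval, where each
    derivative of the outer function is bounded. This yields open domains and uniform constants.

    Nonzero constants are not integrable on the line, hence the recurring splitting of [a (u x)]
    into [a (u x) - a 0] and [a 0].

    The product estimate loses a derivative in one factor, which a Fréchet topology tolerates. As
    [a \o u] has derivative [(a' \o u) u'], each estimate is proved for all outer functions at once
    and the induction on the order passes from [a] to [a'].

    The metrics match since [alpha' s = (1 + s)^(1/r - 1)]: the product of [alpha'] at [f'] with
    [1 + f'] is [(1 + f')^(1/r)], whose [r]-th power is the Jacobian of [id + f]. *)

Definition L1norm f : R := \int[mu]_x `|f x|.

Lemma derive1_is_derive f g : (forall x, is_derive x (1 : R) f (g x)) -> f^`() = g.
Proof. by move=> h; apply/funext => x; rewrite derive1E; exact: derive_val. Qed.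

Lemma derivable_is_derive1 f x : derivable f x 1 -> is_derive x (1 : R) f (f^`() x).
Proof. by move=> h; rewrite derive1E; exact/derivableP. Qed.

Lemma derivable_continuousT f : (forall x, derivable f x 1) -> continuous f.
Proof.
by move=> h x; apply: differentiable_continuous; exact/derivable1_diffP.
Qed.

Lemma continuous_measurableT f : continuous f -> measurable_fun setT f.
Proof. exact: continuous_measurable_fun. Qed.

Lemma integrable_fun_measurable f : integrable_fun f -> measurable_fun setT f.
Proof. by move=> /integrableP[/measurable_EFinP]. Qed.

Lemma integrable_funD f g : integrable_fun f -> integrable_fun g ->
  integrable_fun (fun x => f x + g x).
Proof.
move=> If Ig; rewrite /integrable_fun.
rewrite (_ : _ \o _ = (EFin \o f) \+ (EFin \o g))%E; last by apply/funext.
exact: integrableD.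
Qed.

Lemma integrable_funZ c f : integrable_fun f -> integrable_fun (fun x => c * f x).
Proof.
move=> If; rewrite /integrable_fun.
rewrite (_ : _ \o _ = (fun x => c%:E * (EFin \o f) x)%E); last by apply/funext.
exact: integrableZl.
Qed.

Lemma integrable_funN f : integrable_fun f -> integrable_fun (fun x => - f x).
Proof.
by move=> /(integrable_funZ (-1)); under eq_fun do rewrite mulN1r.
Qed.

Lemma integrable_funB f g : integrable_fun f -> integrable_fun g ->
  integrable_fun (fun x => f x - g x).
Proof. by move=> If /integrable_funN; exact: integrable_funD. Qed.

Lemma le_integrable_fun B f g : measurable_fun setT f ->
  (forall x, `|f x| <= B * `|g x|) -> integrable_fun g -> integrable_fun f.
Proof.
move=> mf fg Ig; have B0 : integrable_fun (fun x => B * g x).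
  exact: integrable_funZ.
apply: (le_integrable _ _ _ B0) => //; first exact/measurable_EFinP.
move=> x _; rewrite lee_fin normrM (le_trans (fg x))// ler_wpM2r//.
exact: ler_norm.
Qed.

Lemma integrable_fun_norm f : integrable_fun f -> integrable_fun (fun x => `|f x|).
Proof. by move=> If; have := integrable_norm If. Qed.

Lemma L1norm_ge0 f : 0 <= L1norm f.
Proof. by apply: Rintegral_ge0. Qed.

Lemma L1normD f g : integrable_fun f -> integrable_fun g ->
  L1norm (fun x => f x + g x) <= L1norm f + L1norm g.
Proof.
move=> If Ig; rewrite /L1norm -RintegralD//; [|exact: integrable_fun_norm..].
apply: le_Rintegral => //.
- by apply: integrable_fun_norm; exact: integrable_funD.
- by apply: integrable_funD; exact: integrable_fun_norm.
- by move=> x _; exact: ler_normD.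
Qed.

Lemma le_L1norm B f g : integrable_fun g -> measurable_fun setT f ->
  (forall x, `|f x| <= B * `|g x|) -> L1norm f <= B * L1norm g.
Proof.
move=> Ig mf fg; rewrite /L1norm -RintegralZl//; last exact: integrable_fun_norm.
apply: le_Rintegral => //.
- apply: integrable_fun_norm; exact: le_integrable_fun fg Ig.
- by apply: integrable_funZ; exact: integrable_fun_norm.
Qed.

Lemma L1normZ c f : integrable_fun f -> L1norm (fun x => c * f x) = `|c| * L1norm f.
Proof.
move=> If; rewrite /L1norm -RintegralZl//; last exact: integrable_fun_norm.
by apply: eq_Rintegral => x _; rewrite normrM.
Qed.

Lemma Rintegral_subset_le f (A : set R) : measurable A -> integrable_fun f ->
  \int[mu]_(x in A) `|f x| <= L1norm f.
Proof.
move=> mA If; rewrite /L1norm Rintegral_mkcond.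
apply: le_Rintegral => //.
- rewrite -restrict_EFin; apply/integrable_restrict => //=; rewrite setTI.
  by apply: integrableS (integrable_fun_norm If).
- exact: integrable_fun_norm.
- by move=> x _; rewrite patchE; case: ifP => // _; exact: normr_ge0.
Qed.

Lemma FTC2_Rintegral f a b : (forall x, derivable f x 1) -> continuous f^`() ->
  a <= b -> \int[mu]_(x in `[a, b]) derive1 f x = f b - f a.
Proof.
move=> df cf'; rewrite le_eqVlt => /predU1P[<-|ab].
  by rewrite set_itv1 Rintegral_set1 subrr.
have cf := derivable_continuousT df.
have dof : derivable_oo_LRcontinuous f a b.
  split; [by move=> x _|apply: cvg_at_right_filter|apply: cvg_at_left_filter].
    exact: cf.
  exact: cf.
have cof : {within `[a, b], continuous f^`()} by exact: continuous_subspaceT.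
by rewrite /Rintegral (continuous_FTC2 ab cof dof).
Qed.

Lemma dist_le_Rintegral f a b : (forall x, derivable f x 1) -> continuous f^`() ->
  integrable_fun f^`() -> a <= b ->
  `|f b - f a| <= \int[mu]_(x in `[a, b]) `|derive1 f x|.
Proof.
move=> df cf' If' ab; rewrite -FTC2_Rintegral//.
by apply: le_normr_Rintegral => //; apply: integrableS If'.
Qed.

(** If [|f|] were at least [d] on a set of infinite measure, its integral would be infinite. The
    interval is a parameter because both the whole line and half-lines occur. *)
Lemma integrable_norm_lt (f : R -> R) (d : R) (i : interval R) : integrable_fun f ->
  mu [set` i] = +oo%E -> 0 < d -> exists2 x, x \in i & `|f x| < d.
Proof.
move=> If ioo d0; apply: contrapT => /forall2NP h.
have {}h x : x \in i -> d <= `|f x|.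
  by move=> xi; case: (h x) => // /negP; rewrite -leNgt.
have /integrableP[_] := If.
suff : (+oo <= \int[mu]_x `|(EFin \o f) x|)%E by rewrite leye_eq => /eqP ->.
have <- : (\int[mu]_(x in [set` i]) d%:E)%E = +oo%E.
  by rewrite integral_cst// [X in (_ * X)%E](_ : _ = +oo%E) ?gt0_muley.
apply: (@le_trans _ _ (\int[mu]_(x in [set` i]) `|(EFin \o f) x|)%E).
  apply: ge0_le_integral => //.
  - by move=> x _; rewrite lee_fin ltW.
  - apply: measurableT_comp => //; apply/measurable_EFinP.
    by apply: measurable_funS (integrable_fun_measurable If).
apply: ge0_subset_integral => //.
apply: measurableT_comp => //; apply/measurable_EFinP.
exact: integrable_fun_measurable.
Qed.

Lemma le_sup_L1norm f x : (forall x, derivable f x 1) -> continuous f^`() ->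
  integrable_fun f -> integrable_fun f^`() -> `|f x| <= L1norm f^`().
Proof.
move=> df cf' If If'; rewrite leNgt; apply/negP => xf.
have [||y _] := @integrable_norm_lt f (`|f x| - L1norm f^`()) `]-oo, +oo[%R If.
- by rewrite lebesgue_measure_itv.
- by rewrite subr_gt0.
(* Otherwise [f], whose oscillation is at most the norm of [f^`()], would be
   bounded away from [0]. *)
apply/negP; rewrite -leNgt lerBlDl -lerBlDr.
apply: (@le_trans _ _ `|f x - f y|); first exact: lerB_dist.
wlog xy : x y {xf} / x <= y.
  by move=> H; have [|/ltW] := leP x y; [exact: H|rewrite distrC; exact: H].
rewrite distrC (le_trans (dist_le_Rintegral _ _ _ _))//.
exact: Rintegral_subset_le.
Qed.

End Calculus.

(** * Smooth cut-off functions *)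

Section Bump.
Context {R : realType}.
Implicit Types (f g u v : R -> R).

Lemma is_derive1_eq f g x (df dg : R) : (forall y, f y = g y) -> df = dg ->
  is_derive x (1 : R) f df -> is_derive x (1 : R) g dg.
Proof. by move=> /funext -> ->. Qed.

Lemma is_derive1D f g x (df dg : R) : is_derive x (1 : R) f df ->
  is_derive x (1 : R) g dg -> is_derive x (1 : R) (fun y => f y + g y) (df + dg).
Proof. by move=> hf hg; apply: is_deriveD. Qed.

Lemma is_derive1M f g x (df dg : R) : is_derive x (1 : R) f df ->
  is_derive x (1 : R) g dg ->
  is_derive x (1 : R) (fun y => f y * g y) (df * g x + f x * dg).
Proof.
move=> hf hg; apply: is_derive1_eq (is_deriveM hf hg) => //.
by rewrite addrC; congr (_ + _); rewrite mulrC.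
Qed.

Lemma is_derive1_cst (c : R) x : is_derive x (1 : R) (fun _ => c) (0 : R).
Proof. exact: is_derive_cst. Qed.

Lemma is_derive1Z c f x (df : R) : is_derive x (1 : R) f df ->
  is_derive x (1 : R) (fun y => c * f y) (c * df).
Proof.
move=> hf; apply: is_derive1_eq (is_derive1M (is_derive1_cst c x) hf) => //.
by rewrite mul0r add0r.
Qed.

Lemma is_derive1B f g x (df dg : R) : is_derive x (1 : R) f df ->
  is_derive x (1 : R) g dg -> is_derive x (1 : R) (fun y => f y - g y) (df - dg).
Proof. by move=> hf hg; apply: is_deriveB. Qed.

Lemma is_derive1_affine (a b x : R) : is_derive x (1 : R) (fun y => a * y + b) a.
Proof.
apply: is_derive1_eq (is_derive1D (is_derive1Z a (is_derive_id x (1 : R)))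
  (is_derive1_cst b x)) => //.
by rewrite mulr1 addr0.
Qed.

(** The factor [x ^- n] in front of exp(-1/x) closes the family under differentiation: each
    derivative combines the members of index [n.+1] and [n.+2]. *)
Definition flat (n : nat) (x : R) : R :=
  if 0 < x then x ^- n * expR (- x^-1) else 0.

Lemma flat_ge0 n x : 0 <= flat n x.
Proof.
by rewrite /flat; case: ifP => // x0; rewrite mulr_ge0 ?expR_ge0 ?invr_ge0 ?exprn_ge0 ?ltW.
Qed.

(** The exponential at [x^-1] exceeds its Taylor term of order [n.+1]; this is one power more than
    [x ^- n] consumes, and the spare factor [x] gives continuity at [0]. *)
Lemma flat_le n x : flat n x <= (n.+1)`!%:R * `|x|.
Proof.
rewrite /flat; case: ifP => x0; last by rewrite mulr_ge0.
rewrite expRN -invfM invf_ple ?posrE ?mulr_gt0 ?exprn_gt0 ?expR_gt0 ?normr_gt0//; last by rewrite gt_eqF.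
have xV0 : 0 <= x^-1 by rewrite invr_ge0 ltW.
rewrite gtr0_norm//.
apply: (@le_trans _ _ (x ^+ n * (x^-1 ^+ n.+1 / (n.+1)`!%:R))).
  have F0 : (n.+1)`!%:R != 0 :> R by rewrite pnatr_eq0 -lt0n fact_gt0.
  have xn0 : x != 0 by rewrite gt_eqF.
  move: F0 (expf_neq0 n xn0).
  rewrite exprVn exprS; move: (_%:R) (x ^+ n) => F y F0 y0.
  rewrite le_eqVlt; apply/orP; left; apply/eqP; field.
  by rewrite y0 F0 xn0.
rewrite ler_wpM2l ?exprn_ge0// ?ltW//.
by apply: lt_le_trans (expR_ge1Dxn n xV0); rewrite ltrDr.
Qed.

Lemma flat0 n : flat n 0 = 0.
Proof. by rewrite /flat ltxx. Qed.

Lemma flat_continuous0 n : {for 0, continuous (flat n)}.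
Proof.
apply/cvgrPdist_le => /= e e0.
have c0 : 0 < (n.+1)`!%:R :> R by rewrite ltr0n fact_gt0.
near=> x; rewrite flat0 sub0r normrN ger0_norm ?flat_ge0//.
apply: (le_trans (flat_le n x)); rewrite -ler_pdivlMl// mulrC.
near: x; have := @nbhs0_le _ R _ (divr_gt0 e0 c0).
by [].
Unshelve. all: by end_near. Qed.

Lemma is_derive_flat n x :
  is_derive x (1 : R) (flat n) (- n%:R * flat n.+1 x + flat n.+2 x).
Proof.
have [x0|x0|->] := ltgtP x 0.
- rewrite /flat (ltNge 0 x) (ltW x0)/= mulr0 addr0.
  apply: near_eq_is_derive (is_derive1_cst 0 x).
  near=> y; rewrite ifF//; apply/negbTE; rewrite -leNgt.
  by rewrite ltW//; near: y; exact: lt_nbhsl.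
- have xn0 : x != 0 by rewrite gt_eqF.
  have dV : is_derive x (1 : R) (fun y => y^-1) (- x ^- 2).
    by apply: is_derive1_eq (is_deriveV xn0 (is_derive_id x (1 : R))) => //;
      rewrite /GRing.scale/= mulr1.
  have dE : is_derive x (1 : R) (fun y => expR (- y^-1)) (expR (- x^-1) * x ^- 2).
    have dN := is_derive1Z (-1) dV.
    have /(is_derive1_comp (is_derive_expR _)) := dN.
    apply: is_derive1_eq => [y|] /=; first by rewrite mulN1r.
    by rewrite !mulN1r opprK.
  have dX : is_derive x (1 : R) (fun y => y ^- n) (- n%:R * x ^- n.+1).
    have := is_deriveX n dV.
    apply: is_derive1_eq => [y|]; first by rewrite -exprVn; elim: n => // n IH; rewrite !exprS -IH.
    rewrite /GRing.scale/=; case: n => [|n]; first by rewrite !mul0r oppr0 mul0r.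
    rewrite /= mulrN mulNr -mulrA; congr (- (_ * _)).
    by rewrite -!exprVn -exprD addn2.
  have nE : \forall y \near x, y ^- n * expR (- y^-1) = flat n y.
    near=> y; rewrite /flat ifT//.
    by near: y; exact: lt_nbhsr.
  apply: is_derive1_eq (near_eq_is_derive nE (is_derive1M dX dE)) => //.
  rewrite /flat x0 !mulrA; congr (_ + _).
  rewrite mulrAC -!exprVn -exprD addn2//.
(* At [0] the identity [flat n z = z * flat n.+1 z] shows that [flat n.+1], continuous and zero at
   [0], is the slope function. *)
- rewrite !flat0 mulr0 addr0; apply/is_derive1_caratheodory.
  exists (flat n.+1); split; [|exact: flat_continuous0|exact: flat0].
  move=> z; rewrite flat0 !subr0 /flat; case: ifP => z0; last by rewrite mul0r.
  by rewrite exprS invfM mulrC [in RHS]mulrC !mulrA divff ?mul1r ?gt_eqF// mulrC.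
Unshelve. all: by end_near. Qed.

(* Closed under differentiation by construction, so that its elements are
   smooth. *)
Inductive elementary : (R -> R) -> Prop :=
| elementary_flat n : elementary (flat n)
| elementary_cst c : elementary (fun=> c)
| elementaryD f g : elementary f -> elementary g ->
    elementary (fun x => f x + g x)
| elementaryM f g : elementary f -> elementary g ->
    elementary (fun x => f x * g x)
| elementaryV f : (forall x, f x != 0) -> elementary f ->
    elementary (fun x => (f x)^-1)
| elementary_affine a b f : elementary f -> elementary (fun x => f (a * x + b)).

Lemma elementary_derive f : elementary f ->
  exists2 g, elementary g & forall x, is_derive x (1 : R) f (g x).
Proof.
elim=> {f}.
- move=> n; exists (fun x => (- n%:R) * flat n.+1 x + flat n.+2 x).
    by do ![apply: elementaryD|apply: elementaryM|apply: elementary_cst|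
            apply: elementary_flat].
  by move=> x; exact: is_derive_flat.
- move=> c; exists (fun=> 0); first exact: elementary_cst.
  by move=> x; exact: is_derive1_cst.
- move=> f g _ [f' ef' df] _ [g' eg' dg]; exists (fun x => f' x + g' x).
    exact: elementaryD.
  by move=> x; exact: is_derive1D.
- move=> f g ef [f' ef' df] eg [g' eg' dg].
  exists (fun x => f' x * g x + f x * g' x).
    by apply: elementaryD; exact: elementaryM.
  by move=> x; exact: is_derive1M.
- move=> f f0 ef [f' ef' df].
  exists (fun x => (-1) * (((f x)^-1 * (f x)^-1) * f' x)).
    apply: elementaryM; first exact: elementary_cst.
    by apply: elementaryM => //; apply: elementaryM; exact: elementaryV.
  move=> x; apply: is_derive1_eq (is_deriveV (f0 x) (df x)) => //.
  by rewrite /GRing.scale/= expr2 invfM mulN1r mulNr.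
- move=> a b f ef [f' ef' df]; exists (fun x => a * f' (a * x + b)).
    by apply: elementaryM; [exact: elementary_cst|exact: elementary_affine].
  move=> x.
  apply: is_derive1_eq (is_derive1_comp (df _) (is_derive1_affine a b x)) => //.
  by rewrite mulrC.
Qed.

Lemma elementary_derivable f x : elementary f -> derivable f x 1.
Proof. by move=> /elementary_derive[g _ /(_ x) []]. Qed.

Lemma elementary_derive1 f : elementary f -> elementary f^`().
Proof. by move=> /elementary_derive[g ? /derive1_is_derive ->]. Qed.

Lemma elementary_derive1n n f : elementary f -> elementary f^`(n).
Proof.
by move=> ef; elim: n => // n IH; rewrite derive1nS; exact: elementary_derive1.
Qed.

Definition smoothstep (x : R) : R := flat 0 x / (flat 0 x + flat 0 (1 - x)).

Lemma flat_gt0 n x : 0 < x -> 0 < flat n x.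
Proof. by move=> x0; rewrite /flat x0 mulr_gt0 ?expR_gt0 ?invr_gt0 ?exprn_gt0. Qed.

Lemma flat_le0 n x : x <= 0 -> flat n x = 0.
Proof. by move=> x0; rewrite /flat ltNge x0. Qed.

Lemma smoothstep_den x : 0 < flat 0 x + flat 0 (1 - x).
Proof.
have [x0|x0] := ltP 0 x; first by rewrite ltr_pwDl ?flat_gt0 ?flat_ge0.
by rewrite ltr_wpDl ?flat_ge0// flat_gt0//; lra.
Qed.

Lemma smoothstep_elementary : elementary smoothstep.
Proof.
apply: elementaryM; first exact: elementary_flat.
apply: elementaryV; first by move=> x; rewrite gt_eqF ?smoothstep_den.
apply: elementaryD; first exact: elementary_flat.
rewrite (_ : (fun x => _) = (fun x => flat 0 ((-1) * x + 1))).
  by apply: elementary_affine; exact: elementary_flat.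
by apply/funext => x; rewrite mulN1r addrC.
Qed.

Lemma smoothstep_le0 x : x <= 0 -> smoothstep x = 0.
Proof. by move=> x0; rewrite /smoothstep flat_le0// mul0r. Qed.

Lemma smoothstep_ge1 x : 1 <= x -> smoothstep x = 1.
Proof.
move=> x1; have := smoothstep_den x; rewrite /smoothstep [flat 0 (1 - x)]flat_le0 ?subr_le0//.
by rewrite addr0 => ?; rewrite divff// gt_eqF.
Qed.

Lemma smoothstep_ge0 x : 0 <= smoothstep x.
Proof. by rewrite divr_ge0 ?flat_ge0 ?ltW ?smoothstep_den. Qed.

Lemma smoothstep_le1 x : smoothstep x <= 1.
Proof. by rewrite ler_pdivrMr ?smoothstep_den// mul1r lerDl flat_ge0. Qed.

Lemma derive1_smoothstep_eq0 x : (x < 0) || (1 < x) -> smoothstep^`() x = 0.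
Proof.
move=> x01; suff : exists c, \forall y \near x, smoothstep y = c.
  case=> c H; have := near_eq_is_derive (g := smoothstep) _ (is_derive1_cst c x).
  rewrite derive1E => h; apply: (@derive_val _ _ _ _ _ _ _ (h _)).
  by near=> y; apply/esym; near: y.
move/orP : x01 => [x0|x1]; [exists 0|exists 1]; near=> y.
  by apply: smoothstep_le0; rewrite ltW//; near: y; exact: lt_nbhsl.
by apply: smoothstep_ge1; rewrite ltW//; near: y; exact: lt_nbhsr.
Unshelve. all: by end_near. Qed.

(** The derivative is continuous and vanishes off [[0, 1]], so the maximum of its absolute value
    there bounds it everywhere. *)
Lemma derive1_smoothstep_bounded :
  exists2 C : R, 0 < C & forall x, `|smoothstep^`() x| <= C.
Proof.
have cf : continuous (fun x => `|smoothstep^`() x|).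
  move=> x; apply: (@cvg_norm _ R) => /=.
  apply: derivable_continuousT => y; apply: elementary_derivable.
  exact/elementary_derive1/smoothstep_elementary.
have [|c c01 h] := @EVT_max R (fun x => `|smoothstep^`() x|) 0 1 ler01.
  exact: continuous_subspaceT.
exists (`|smoothstep^`() c| + 1); first by rewrite ltr_wpDl.
move=> x; have [x0|x0] := ltP x 0.
  by rewrite derive1_smoothstep_eq0 ?x0// normr0 addr_ge0.
have [x1|x1] := ltP 1 x.
  by rewrite derive1_smoothstep_eq0 ?x1 ?orbT// normr0 addr_ge0.
by rewrite (le_trans (h x _)) ?lerDl// in_itv/= x0.
Qed.

End Bump.

(** * Weak derivatives *)

Section WeakDerivative.
Context {R : realType}.
Implicit Types (f g u v eta : R -> R) (a b e x M : R).
Local Notation mu := (@lebesgue_measure R).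

(* Rises from [0] to [1] on [[a, a + e]]. *)
Definition step (a e : R) (x : R) : R := smoothstep (e^-1 * x + - (e^-1 * a)).

Lemma step_elementary a e : elementary (step a e).
Proof. exact: (elementary_affine e^-1 (- (e^-1 * a)) smoothstep_elementary). Qed.

Lemma step_arg a e x : e^-1 * x + - (e^-1 * a) = (x - a) / e.
Proof. by rewrite -mulrBr mulrC. Qed.

Lemma step_lea a e x : 0 < e -> x <= a -> step a e x = 0.
Proof.
move=> e0 xa; rewrite /step step_arg smoothstep_le0//.
by rewrite pmulr_lle0 ?invr_gt0// subr_le0.
Qed.

Lemma step_gea a e x : 0 < e -> a + e <= x -> step a e x = 1.
Proof.
move=> e0 xa; rewrite /step step_arg smoothstep_ge1//.
by rewrite ler_pdivlMr// mul1r lerBrDl.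
Qed.

Lemma derive1_stepE a e : (step a e)^`() =
  (fun x => e^-1 * derive1 smoothstep ((x - a) / e)).
Proof.
apply: derive1_is_derive => x.
have h y : is_derive y (1 : R) smoothstep (smoothstep^`() y).
  by apply: derivable_is_derive1; exact/elementary_derivable/smoothstep_elementary.
apply: is_derive1_eq (is_derive1_comp (h _) (is_derive1_affine e^-1 (- (e^-1 * a)) x)) => //.
by rewrite step_arg mulrC.
Qed.

Lemma derive1_step_eq0 a e x : 0 < e -> (x < a) || (a + e < x) ->
  (step a e)^`() x = 0.
Proof.
move=> e0 xae; rewrite derive1_stepE derive1_smoothstep_eq0 ?mulr0//.
by rewrite ltr_pdivrMr// mul0r subr_lt0 ltr_pdivlMr// mul1r ltrBrDl.
Qed.

Lemma derive1_step_continuous a e : continuous (step a e)^`().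
Proof.
apply: derivable_continuousT => x; apply: elementary_derivable.
exact/elementary_derive1/step_elementary.
Qed.

Lemma derive1_step_bounded :
  exists2 C : R, 0 < C & forall a e x, 0 < e -> `|(step a e)^`() x| <= C / e.
Proof.
have [C C0 h] := @derive1_smoothstep_bounded R; exists C => // a e x e0.
rewrite derive1_stepE normrM [`|e^-1|]gtr0_norm ?invr_gt0// mulrC.
by rewrite ler_pM2r ?invr_gt0.
Qed.

Lemma elementary_test f M : elementary f -> (forall x, M < `|x| -> f x = 0) ->
  test_function f.
Proof.
move=> ef fM; split; last by exists M.
by move=> n x; exact/elementary_derivable/elementary_derive1n.
Qed.

Lemma test_derive1_step a e : 0 < e -> test_function (step a e)^`().
Proof.
move=> e0; apply: (@elementary_test _ (`|a| + e)).
  exact/elementary_derive1/step_elementary.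
move=> x; rewrite ltr_normr => /orP[xa|xa]; apply: derive1_step_eq0 => //; apply/orP.
  by right; have := ler_norm a; lra.
by left; have := ler_norm (- a); rewrite normrN; lra.
Qed.

Lemma test_step a b e : 0 < e -> a < b ->
  test_function (fun x => step a e x + (-1) * step b e x).
Proof.
move=> e0 ab; apply: (@elementary_test _ (`|a| + `|b| + e)).
  apply: elementaryD; first exact: step_elementary.
  by apply: elementaryM; [exact: elementary_cst|exact: step_elementary].
have := ler_norm (- a); rewrite normrN => a0; have := ler_norm b => b0.
have := normr_ge0 a; have := normr_ge0 b => b1 a1.
move=> x; rewrite ltr_normr => /orP[xa|xa].
  by rewrite !step_gea ?mulr1 ?subrr//; lra.
by rewrite !step_lea ?mulr0 ?addr0//; lra.
Qed.

Lemma Rintegral_derive1_step a e : 0 < e ->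
  \int[mu]_(x in `[a, a + e]) (derive1 (step a e) x) = 1.
Proof.
move=> e0; rewrite FTC2_Rintegral ?lerDl ?ltW//.
- by rewrite step_gea// step_lea// subr0.
- by move=> x; exact/elementary_derivable/step_elementary.
- exact: derive1_step_continuous.
Qed.

Lemma integrable_fun_step f a e : 0 < e -> integrable_fun f ->
  integrable_fun (fun x => f x * derive1 (step a e) x).
Proof.
move=> e0 If; have [C C0 h] := derive1_step_bounded.
apply: (@le_integrable_fun _ (C / e) _ f) => //.
  apply: measurable_funM; first exact: integrable_fun_measurable.
  by apply: continuous_measurableT; exact: derive1_step_continuous.
by move=> x; rewrite normrM mulrC ler_wpM2r// h.
Qed.

Lemma Rintegral_eq_in f (A : set R) : measurable A -> (forall x, ~ A x -> f x = 0) ->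
  \int[mu]_x f x = \int[mu]_(x in A) f x.
Proof.
move=> mA fA; rewrite [RHS]Rintegral_mkcond; apply: eq_Rintegral => x _.
rewrite patchE; case: ifPn => //.
by move=> /negP xA; apply: fA => Ax; apply: xA; exact/mem_set.
Qed.

(** The derivative of [step a e] is a one-sided mollifier: mass one on [[a, a + e]], height O(1/e).
    Integrating against it therefore misses [f a] by at most a multiple of a mean of [|f - f a|].
    The factor 4 comes from [davg], whose ball of radius [2 * e] contains the closed interval and
    has length [4 * e]. *)
Lemma le_step_davg : exists2 C : R, 0 < C & forall f a e, 0 < e ->
  integrable_fun f ->
  (`|\int[mu]_x (f x * derive1 (step a e) x) - f a|%:E <=
   C%:E * davg f a (2 * e))%E.
Proof.
have [C C0 h] := derive1_step_bounded; exists (C *+ 4); first by rewrite pmulrn_rgt0.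
move=> f a e e0 If.
have mI : measurable `[a, a + e] by [].
have Ic : mu.-integrable `[a, a + e] (EFin \o (fun x => f a * derive1 (step a e) x)).
  apply: continuous_compact_integrable; first exact: segment_compact.
  apply: continuous_subspaceT => x; apply: cvgM; first exact: cvg_cst.
  exact: derive1_step_continuous.
have Ifs : mu.-integrable `[a, a + e] (EFin \o (fun x => f x * derive1 (step a e) x)).
  by apply: integrableS (integrable_fun_step a e0 If).
have Is : mu.-integrable `[a, a + e] (EFin \o (fun x => derive1 (step a e) x)).
  apply: continuous_compact_integrable; first exact: segment_compact.
  exact/continuous_subspaceT/derive1_step_continuous.
rewrite (@Rintegral_eq_in _ `[a, a + e])//; last first.
  move=> x /=; rewrite in_itv/= => /negP; rewrite negb_and -!ltNge => xI.
  by rewrite derive1_step_eq0 ?mulr0.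
(* The number [f a] becomes an integral because the mollifier has mass one. *)
rewrite -[X in _ - X]mulr1 -[X in _ - _ * X](Rintegral_derive1_step a e0) -RintegralZl//.
rewrite -RintegralB//.
have If1 : mu.-integrable `[a, a + e] (EFin \o (fun x => f x - f a)).
  rewrite (_ : _ \o _ = (EFin \o f) \- (EFin \o cst (f a)))%E; last by apply/funext.
  apply: integrableB => //; first by apply: integrableS If.
  apply: continuous_compact_integrable; first exact: segment_compact.
  by apply: continuous_subspaceT => x; exact: cvg_cst.
under eq_Rintegral do rewrite -mulrBl.
have Ip : mu.-integrable `[a, a + e]
    (EFin \o (fun x => (f x - f a) * derive1 (step a e) x)).
  rewrite (_ : _ \o _ = (EFin \o (fun x => f x * derive1 (step a e) x)%R) \-
    (EFin \o (fun x => f a * derive1 (step a e) x)%R))%E.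
    exact: integrableB.
  by apply/funext => x /=; rewrite -EFinB mulrBl.
rewrite EFin_normr_Rintegral//.
apply: (le_trans (le_abse_integral _ _ _)) => //.
  by case/integrableP: Ip.
have mfa A : measurable A -> measurable_fun A (fun x => `|(f x - f a)%:E|%E).
  move=> mA; apply: measurableT_comp => //; apply/measurable_EFinP.
  apply: measurable_funB => //.
  by apply: measurable_funS (integrable_fun_measurable If).
apply: le_trans.
  apply: (@ge0_le_integral _ _ _ mu `[a, a + e] mI _
    (fun x => ((C / e)%:E * `|(f x - f a)%:E|)%E)) => //.
  - by apply: measurableT_comp => //; case/integrableP: Ip.
  - by apply: measurable_funeM; exact: mfa.
  - move=> x _ /=; rewrite -EFinM lee_fin normrM mulrC ler_wpM2r// h//.
rewrite ge0_integralZl//; last 2 first.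
  exact: mfa.
  by rewrite lee_fin divr_ge0// ltW.
rewrite /davg /iavg lebesgue_measure_ball ?mulr_ge0 ?(ltW e0)//.
rewrite inver ifF; last first.
  by apply: gt_eqF; rewrite pmulrn_lgt0// mulr_gt0.
rewrite muleA -EFinM.
have -> : C *+ 4 * (2 * e *+ 2)^-1 = C / e.
  by rewrite -mulr_natl -[_ *+ 2]mulr_natl; field; rewrite gt_eqF.
rewrite lee_wpmul2l ?lee_fin ?divr_ge0 ?(ltW e0) ?(ltW C0)//.
apply: ge0_subset_integral => //.
- exact: measurable_ball.
- by apply: mfa; exact: measurable_ball.
- by move=> x /=; rewrite ball_itv/= !in_itv/= => /andP[ax xe]; lra.
Qed.

Definition eps (n : nat) : R := n.+1%:R^-1.

Lemma eps_gt0 n : 0 < eps n. Proof. by rewrite invr_gt0. Qed.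

Lemma eps_cvg0 : eps n @[n --> \oo] --> 0.
Proof. exact: cvg_harmonic. Qed.

Lemma step_lebesgue_pt f a : integrable_fun f -> lebesgue_pt f a ->
  \int[mu]_x (f x * derive1 (step a (eps n)) x) @[n --> \oo] --> f a.
Proof.
move=> If fa; have [C C0 h] := le_step_davg.
apply/cvgrPdist_le => /= d d0.
have e2 : 2 * eps n @[n --> \oo] --> 0^'+.
  have e20 : 2 * eps n @[n --> \oo] --> 0.
    rewrite -[X in _ --> X](mulr0 2); apply: cvgM; first exact: cvg_cst.
    exact: eps_cvg0.
  move=> A A0; suff : \forall n \near \oo, A (2 * eps n) by [].
  near=> n; have : 0 < 2 * eps n -> A (2 * eps n) by near: n; exact: (e20 (fun x => 0 < x -> A x) A0).
  by apply; rewrite mulr_gt0// eps_gt0.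
move: fa => /(cvg_comp _ _ e2)/= /fine_cvgP[fin].
move=> /cvgrPdist_le /(_ (d / C) (divr_gt0 d0 C0)) dC.
near=> n; rewrite distrC -lee_fin.
apply: (le_trans (h f a _ (eps_gt0 n) If)).
have fn : davg f a (2 * eps n) \is a fin_num by near: n.
rewrite -(fineK fn) -EFinM lee_fin -ler_pdivlMl// [leRHS]mulrC.
have : `|0 - (fine \o davg f a) (2 * eps n)| <= d / C by near: n.
by rewrite sub0r normrN; apply: le_trans; exact: ler_norm.
Unshelve. all: by end_near. Qed.

Lemma step_cvg a x : step a (eps n) x @[n --> \oo] --> (if a < x then 1 else 0 : R).
Proof.
case: ifPn => [ax|]; last first.
  rewrite -leNgt => xa; rewrite (_ : (fun n => _) = cst 0); first exact: cvg_cst.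
  by apply/funext => n; rewrite step_lea// eps_gt0.
apply: cvg_near_cst; near=> n; apply/eqP; rewrite step_gea ?eps_gt0//.
rewrite -lerBrDl.
near: n; move/cvgrPdist_le : eps_cvg0 => /(_ (x - a)); rewrite subr_gt0 => /(_ ax).
by apply: filterS => n; rewrite sub0r normrN; exact: le_trans (ler_norm _).
Unshelve. all: by end_near. Qed.

Lemma step_itv a e x : 0 < e -> 0 <= step a e x <= 1.
Proof. by move=> e0; rewrite smoothstep_ge0 smoothstep_le1. Qed.

Lemma step_continuous a e : continuous (step a e).
Proof.
by apply: derivable_continuousT => x; exact/elementary_derivable/step_elementary.
Qed.

Lemma derive1_step_diff a b e x :
  derive1 (fun x => step a e x + (-1) * step b e x) x =
  derive1 (step a e) x - derive1 (step b e) x.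
Proof.
have d c y : is_derive y (1 : R) (step c e) ((step c e)^`() y).
  by apply: derivable_is_derive1; exact/elementary_derivable/step_elementary.
rewrite derive1E; apply: derive_val.
apply: is_derive1_eq (is_derive1D (d a x) (is_derive1Z (-1) (d b x))) => //.
by rewrite mulN1r.
Qed.

(** Dominated convergence with majorant [|g|]. The limit interval is open at [a] and closed at [b]
    because each step vanishes at its starting point. *)
Lemma Rintegral_step_cvg g a b : integrable_fun g -> a < b ->
  \int[mu]_x (g x * (step a (eps n) x + (-1) * step b (eps n) x)) @[n --> \oo] -->
  \int[mu]_(x in `]a, b]) g x.
Proof.
move=> Ig ab; rewrite Rintegral_mkcond.
set G := g \_ _.
have mg := integrable_fun_measurable Ig.
have mI : measurable `]a, b] by [].
have IG : integrable_fun G.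
  rewrite /integrable_fun -restrict_EFin.
  by apply/integrable_restrict => //=; rewrite setTI; apply: integrableS Ig.
apply: fine_cvg; rewrite fineK; last exact: integrable_fin_num.
apply: (@dominated_cvg _ _ _ mu setT _ _ _ (fun x => `|(g x)%:E|%E)) => //.
- move=> n; apply/measurable_EFinP; apply: measurable_funM => //.
  apply: measurable_funD; first by apply: continuous_measurableT; exact: step_continuous.
  by apply: measurable_funM => //; apply: continuous_measurableT; exact: step_continuous.
- move=> x _; apply: cvg_EFin; first by near=> n.
  rewrite (_ : G x = g x * ((if a < x then 1 else 0) + (-1) * (if b < x then 1 else 0))).
    apply: cvgM; first exact: cvg_cst.
    apply: cvgD; first exact: step_cvg.
    by apply: cvgM; [exact: cvg_cst|exact: step_cvg].
  rewrite /G patchE; case: ifPn => [|/negP] xI.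
    move: xI; rewrite inE/= in_itv/= => /andP[-> xb].
    by rewrite ltNge xb/= mulr0 addr0 mulr1.
  have [ax|xa] := ltP a x; have [bx|xb] := ltP b x.
  + by rewrite mulr1 subrr mulr0.
  + by exfalso; apply: xI; rewrite inE/= in_itv/= ax.
  + by have := lt_trans ab bx; rewrite ltNge xa.
  + by rewrite mulr0 addr0 mulr0.
- exact: integrable_abse.
- move=> n x _; rewrite lee_fin normrM ler_piMr//.
  have /andP[s0 s1] := step_itv a x (eps_gt0 n).
  have /andP[t0 t1] := step_itv b x (eps_gt0 n).
  by rewrite ler_norml; apply/andP; split; lra.
Unshelve. all: by end_near. Qed.

(* Test against [step a e - step b e], a smoothed indicator function of
   [[a, b]], and let [e] tend to [0]. *)
Lemma weak_FTC f g a b : integrable_fun f -> integrable_fun g ->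
  is_weak_derivn 1 f g -> a < b -> lebesgue_pt f a -> lebesgue_pt f b ->
  f b - f a = \int[mu]_(x in `]a, b]) g x.
Proof.
move=> If Ig fg ab fa fb.
have : (\int[mu]_x (f x * derive1 (step b (eps n)) x) -
        \int[mu]_x (f x * derive1 (step a (eps n)) x)) @[n --> \oo] --> f b - f a.
  by apply: cvgB; exact: step_lebesgue_pt.
move=> /cvg_unique; apply; first exact: Rhausdorff.
rewrite (_ : (fun n => _ - _) = (fun n => \int[mu]_x (g x * (step a (eps n) x + (-1) * step b (eps n) x)))).
  exact: Rintegral_step_cvg.
apply/funext => n.
have := fg _ (test_step (eps_gt0 n) ab).
rewrite expr1 mulN1r => /(congr1 -%R); rewrite opprK => <-.
rewrite -[LHS]opprB; congr (- _).
rewrite -RintegralB//; [|exact: integrable_fun_step (eps_gt0 n) If..].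
by apply: eq_Rintegral => x _; rewrite derive1n1 derive1_step_diff mulrBr.
Qed.

(** The derivatives of the steps are test functions of mass one shrinking to [a], so integrals that
    all vanish converge to [g a]. *)
Lemma weak_eq0 g a : integrable_fun g ->
  (forall eta, test_function eta -> \int[mu]_x (g x * eta x) = 0) ->
  lebesgue_pt g a -> g a = 0.
Proof.
move=> Ig g0 ga; have := step_lebesgue_pt Ig ga.
move=> /cvg_unique; apply; first exact: Rhausdorff.
rewrite (_ : (fun n => _) = cst 0); first exact: cvg_cst.
by apply/funext => n; rewrite g0//; apply: test_derive1_step; exact: eps_gt0.
Qed.

Lemma ae_imply (P Q : R -> Prop) : (forall x, P x -> Q x) ->
  {ae mu, forall x, P x} -> {ae mu, forall x, Q x}.
Proof. by move=> PQ; apply: filterS; [exact: (ae_filter_ringOfSetsType mu)|exact: PQ]. Qed.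

Lemma ae_lebesgue_pt f : integrable_fun f -> {ae mu, forall x, lebesgue_pt f x}.
Proof.
move=> If; apply: lebesgue_differentiation.
by apply: open_integrable_locally => //; exact: openT.
Qed.

Lemma continuous_lebesgue_ptT f x : continuous f -> lebesgue_pt f x.
Proof.
move=> cf; apply: (@continuous_lebesgue_pt _ f x setT) => //.
- by split => //; exact: openT.
- exact: continuous_measurableT.
- exact: cf.
Qed.

Lemma ae_exists (P : R -> Prop) : {ae mu, forall x, P x} -> exists x, P x.
Proof.
move=> [N [mN N0 hN]]; apply: contrapT => /forallNP nP.
have : mu N = +oo%E.
  apply/eqP; rewrite -leye_eq.
  have <- : mu [set: R] = +oo%E.
    by rewrite -set_itvNyy lebesgue_measure_itv.
  by apply: le_measure => //; rewrite ?inE// => x _; apply: hN; exact: nP.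
by rewrite N0.
Qed.

Lemma test_bounded eta : test_function eta -> exists2 C : R, 0 < C & forall x, `|eta x| <= C.
Proof.
move=> [deta [M h]].
have ceta : continuous eta.
  by apply: derivable_continuousT => x; exact: (deta 0%N).
have cf : continuous (fun x => `|eta x|).
  by move=> x; apply: (@cvg_norm _ R) => /=; exact: ceta.
have [||c c01 hc] := @EVT_max R (fun x => `|eta x|) (- `|M|) `|M|.
- by rewrite (@le_trans _ _ 0)// oppr_le0.
- exact: continuous_subspaceT.
exists (`|eta c| + 1); first by rewrite ltr_wpDl.
move=> x; have [xM|xM] := ltP M `|x|; first by rewrite h// normr0 addr_ge0.
rewrite (le_trans (hc x _)) ?lerDl// in_itv/= -ler_norml (le_trans xM)//.
exact: ler_norm.
Qed.

Lemma test_continuous eta : test_function eta -> continuous eta.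
Proof. by move=> [d _]; apply: derivable_continuousT => x; exact: (d 0%N). Qed.

Lemma integrable_fun_test f eta : integrable_fun f -> test_function eta ->
  integrable_fun (fun x => f x * eta x).
Proof.
move=> If te; have [C C0 h] := test_bounded te.
apply: (@le_integrable_fun _ C _ f) => //.
  apply: measurable_funM; first exact: integrable_fun_measurable.
  by apply: continuous_measurableT; exact: test_continuous.
by move=> x; rewrite normrM mulrC ler_wpM2r.
Qed.

Lemma weak_derivn_unique j f g1 g2 : integrable_fun g1 -> integrable_fun g2 ->
  is_weak_derivn j f g1 -> is_weak_derivn j f g2 -> {ae mu, forall x, g1 x = g2 x}.
Proof.
move=> I1 I2 w1 w2; have I12 := integrable_funB I1 I2.
have := ae_lebesgue_pt I12; apply: ae_imply => x.
move=> /(weak_eq0 I12) g12; apply/eqP; rewrite -subr_eq0; apply/eqP; apply: g12.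
move=> eta te; under eq_Rintegral do rewrite mulrBl.
rewrite RintegralB//; [|exact: integrable_fun_test..].
have := w2 _ te; rewrite w1// => /(congr1 ( *%R ((-1) ^+ j))).
by rewrite !signrMK => ->; rewrite subrr.
Qed.

Lemma ae_eq_Rintegral f g : measurable_fun setT f -> measurable_fun setT g ->
  {ae mu, forall x, f x = g x} -> \int[mu]_x f x = \int[mu]_x g x.
Proof.
move=> mf mg fg; congr fine; apply: ae_eq_integral => //.
- exact/measurable_EFinP.
- exact/measurable_EFinP.
- by move: fg; apply: ae_imply => x -> _.
Qed.

Lemma ae_eq_integrable_fun f g : measurable_fun setT f ->
  {ae mu, forall x, f x = g x} -> integrable_fun g -> integrable_fun f.
Proof.
move=> mf fg Ig; have mg := integrable_fun_measurable Ig.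
apply/integrableP; split; first exact/measurable_EFinP.
case/integrableP: Ig => _; apply: le_lt_trans.
rewrite le_eqVlt; apply/orP; left; apply/eqP; apply: ae_eq_integral => //.
- by apply: measurableT_comp => //; exact/measurable_EFinP.
- by apply: measurableT_comp => //; exact/measurable_EFinP.
- by move: fg; apply: ae_imply => x /= -> _.
Qed.

Definition primitive f (x : R) : R := \int[mu]_(t in `]-oo, x]) f t.

Lemma primitiveB f a b : integrable_fun f -> a <= b ->
  primitive f b - primitive f a = \int[mu]_(x in `]a, b]) f x.
Proof.
move=> If ab; apply: Rintegral_itvB; rewrite ?bnd_simp//.
by apply: integrableS If.
Qed.

Lemma is_derive_primitive f x : integrable_fun f -> continuous f ->
  is_derive x (1 : R) (primitive f) (f x).
Proof.
move=> If cf.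
have [||||d <-] := @continuous_FTC1 R f -oo%O x (x + 1).
- by rewrite ltrDl.
- by apply: integrableS If.
- by rewrite ltNyr.
- exact: cf.
- exact: derivable_is_derive1.
Qed.

Lemma primitive_dist f x y : integrable_fun f -> x <= y ->
  `|primitive f y - primitive f x| <= \int[mu]_(t in `]x, y]) `|f t|.
Proof.
move=> If xy; rewrite primitiveB//; apply: le_normr_Rintegral => //.
by apply: integrableS If.
Qed.

Lemma measure_itv_lt x y (d : R) : 0 < d -> y - x < d -> (mu `]x, y] < d%:E)%E.
Proof. by move=> d0 xy; rewrite lebesgue_measure_itv/=; case: ifP; rewrite lte_fin. Qed.

Lemma primitive_continuous f : integrable_fun f -> continuous (primitive f).
Proof.
move=> If x; apply/cvgrPdist_lt => /= e e0.
have [d [d0 h]] := integral_normr_continuous If e0.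
near=> y.
have yd : `|x - y| < d by near: y; exact: cvgr_dist_lt.
have [xy|/ltW yx] := leP x y.
  rewrite distrC; apply: le_lt_trans (primitive_dist If xy) _; apply: h => //.
  apply: measure_itv_lt => //; apply: le_lt_trans yd.
  by rewrite distrC; exact: ler_norm.
apply: le_lt_trans (primitive_dist If yx) _; apply: h => //.
by apply: measure_itv_lt => //; apply: le_lt_trans yd; exact: ler_norm.
Unshelve. all: by end_near. Qed.

Lemma test_derive1 eta : test_function eta -> test_function eta^`().
Proof.
move=> [deta [M h]]; split; first by move=> n x; rewrite -derive1Sn; exact: deta.
exists M => x Mx; rewrite derive1E; apply: derive_val.
apply: near_eq_is_derive (is_derive1_cst 0 x).
near=> y; rewrite h//; near: y.
by apply: (@cvgr_gt _ _ _ _ (fun y : R => `|y|) `|x|) => //; exact: (@cvg_norm _ R).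
Unshelve. all: by end_near. Qed.

Lemma test_derive1n j eta : test_function eta -> test_function eta^`(j).
Proof. by move=> te; elim: j => // j IH; rewrite derive1nS; exact: test_derive1. Qed.

(** The [j]-th derivative of a test function is again a test function, to which the first-order
    identity applies. *)
Lemma weak_derivnS j f g h : is_weak_derivn 1 f g -> is_weak_derivn j.+1 f h ->
  is_weak_derivn j g h.
Proof.
move=> fg fh eta te; have := fg _ (test_derive1n j te).
by rewrite derive1n1 -(derive1nS eta j) fh// expr1 exprS !mulN1r mulNr => /oppr_inj <-.
Qed.

Lemma ae_eq_weak_derivn j f g h : measurable_fun setT f -> measurable_fun setT g ->
  {ae mu, forall x, f x = g x} -> is_weak_derivn j g h -> is_weak_derivn j f h.
Proof.
move=> mf mg fg gh eta te; rewrite -gh//.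
have met : measurable_fun setT (derive1n j eta).
  by apply: continuous_measurableT; exact/test_continuous/test_derive1n.
apply: ae_eq_Rintegral; [exact: measurable_funM..|].
by move: fg; apply: ae_imply => x ->.
Qed.

(** Two orders are used: [g1] has weak derivative [g2], so it agrees almost everywhere with a
    continuous primitive [k] of [g2]. As [f] is continuous, all its points are Lebesgue points, and
    [f] is a primitive of [k] everywhere, not just almost everywhere. *)
Lemma continuous_weak_derivative f g1 g2 : continuous f -> integrable_fun f ->
  integrable_fun g1 -> integrable_fun g2 ->
  is_weak_derivn 1 f g1 -> is_weak_derivn 2 f g2 ->
  exists2 k, continuous k /\ (forall x, is_derive x (1 : R) f (k x)) &
             {ae mu, forall x, k x = g1 x}.
Proof.
move=> cf If I1 I2 w1 w2.
have w12 : is_weak_derivn 1 g1 g2 by exact: weak_derivnS w1 w2.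
have ae1 := ae_lebesgue_pt I1.
have [a ha] := ae_exists ae1.
(* The continuous representative of [g1]; the constant is read off a Lebesgue
   point. *)
pose k x := primitive g2 x + (g1 a - primitive g2 a).
have kg x : lebesgue_pt g1 x -> k x = g1 x.
  move=> hx; rewrite /k; have [ax|xa|<-] := ltgtP a x.
  - have := weak_FTC I1 I2 w12 ax ha hx.
    by rewrite -primitiveB ?ltW// => ?; lra.
  - have := weak_FTC I1 I2 w12 xa hx ha.
    by rewrite -primitiveB ?ltW// => ?; lra.
  - lra.
have ck : continuous k.
  by move=> x; apply: cvgD; [exact: primitive_continuous|exact: cvg_cst].
have aek : {ae mu, forall x, k x = g1 x} by apply: ae_imply ae1 => x; exact: kg.
have mk : measurable_fun setT k by exact: continuous_measurableT.
have Ik : integrable_fun k by exact: ae_eq_integrable_fun aek I1.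
exists k => //; split => // x.
have fk y z : y < z -> f z - f y = primitive k z - primitive k y.
  move=> yz; rewrite (weak_FTC If I1 w1 yz); [|exact: continuous_lebesgue_ptT..].
  rewrite primitiveB ?ltW//; rewrite /Rintegral; congr fine.
  apply: ae_eq_integral => //.
  - by apply: measurable_funTS; apply/measurable_EFinP; exact: integrable_fun_measurable.
  - by apply: measurable_funTS; exact/measurable_EFinP.
  - by apply: ae_imply aek => t /= -> _.
have fE y : primitive k y + (f 0 - primitive k 0) = f y.
  by have [y0|y0|->] := ltgtP y 0; [have := fk _ _ y0|have := fk _ _ y0|]; lra.
apply: is_derive1_eq (is_derive1D (is_derive_primitive x Ik ck)
  (is_derive1_cst (f 0 - primitive k 0) x)) => //.
by rewrite addr0.
Qed.

(** One bootstrap step: the classical derivative agrees almost everywhere with the first weak one,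
    and its [j]-th weak derivative is that of [f] of order [j.+1]. *)
Lemma Winf1_derivable f : Winf1 f -> (forall x, derivable f x 1) /\ Winf1 f^`().
Proof.
move=> [cf sf].
have [If _] := sf 0%N.
have [g1 I1 w1] : exists2 g, integrable_fun g & is_weak_derivn 1 f g.
  by case: (sf 1%N) => _; apply.
have [g2 I2 w2] : exists2 g, integrable_fun g & is_weak_derivn 2 f g.
  by case: (sf 2%N) => _; apply.
have [k [ck dk] kg] := continuous_weak_derivative cf If I1 I2 w1 w2.
have mk : measurable_fun setT k by exact: continuous_measurableT.
split; first by move=> x; case: (dk x).
rewrite (derive1_is_derive dk); split => // m; split.
  exact: ae_eq_integrable_fun kg I1.
move=> j _; have [g Ig wg] : exists2 g, integrable_fun g & is_weak_derivn j.+1 f g.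
  by case: (sf j.+1) => _; apply.
exists g => //; apply: ae_eq_weak_derivn kg _ => //.
  exact: integrable_fun_measurable.
exact: (weak_derivnS w1 wg).
Qed.

(** The classical form of [Winf1]; [Winf1P] proves the two equivalent. *)
Definition smoothL1 f :=
  forall n, (forall x, derivable f^`(n) x 1) /\ integrable_fun f^`(n).

Lemma smoothL1_derive1 f : smoothL1 f -> smoothL1 f^`().
Proof. by move=> sf n; have := sf n.+1; rewrite derive1Sn. Qed.

Lemma Winf1_smoothL1 f : Winf1 f -> smoothL1 f.
Proof.
move=> Wf n; elim: n f Wf => [|n IH] f Wf.
  split; first by case: (Winf1_derivable Wf).
  by case: Wf => _ /(_ 0%N)[].
by rewrite derive1Sn; apply: IH; case: (Winf1_derivable Wf).
Qed.

Lemma integration_by_parts_test f eta : smoothL1 f -> test_function eta ->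
  \int[mu]_x (f x * derive1 eta x) = - \int[mu]_x (derive1 f x * eta x).
Proof.
move=> sf te; have [_ [M hM]] := te.
have [N N0 hN] : exists2 N, 0 < N & forall x, N <= `|x| -> eta x = 0 /\ derive1 eta x = 0.
  have [_ [M' hM']] := test_derive1 te.
  exists (`|M| + `|M'| + 1); first by rewrite ltr_wpDl// addr_ge0.
  move=> x; have := ler_norm M; have := ler_norm M'.
  have := normr_ge0 M; have := normr_ge0 M'.
  by split; [apply: hM|apply: hM']; lra.
have df x : derivable f x 1 by case: (sf 0%N).
have df' x : derivable f^`() x 1 by case: (sf 1%N).
have de x : derivable eta x 1 by case: te => /(_ 0%N).
have de' x : derivable eta^`() x 1 by case: te => /(_ 1%N).
have cf' : continuous f^`() := derivable_continuousT df'.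
have ce' : continuous eta^`() := derivable_continuousT de'.
have eq0 x : ~ `[- N, N]%classic x -> N <= `|x|.
  rewrite /= in_itv/= => /negP; rewrite -ler_norml -ltNge; exact: ltW.
rewrite (@Rintegral_eq_in _ `[- N, N])//; last first.
  by move=> x /eq0/hN[_ ->]; rewrite mulr0.
rewrite (@Rintegral_eq_in (fun x => derive1 f x * eta x) `[- N, N])//; last first.
  by move=> x /eq0/hN[-> _]; rewrite mulr0.
have doo g : (forall x, derivable g x 1) -> derivable_oo_LRcontinuous g (- N) N.
  move=> dg; have cg := derivable_continuousT dg.
  split; [by move=> x _|apply: cvg_at_right_filter|apply: cvg_at_left_filter].
    exact: cg.
  exact: cg.
have NN : - N < N by rewrite gtrN.
rewrite (Rintegration_by_parts NN (continuous_subspaceT cf') (doo f df)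
  (fun _ _ => erefl) (continuous_subspaceT ce') (doo eta de) (fun _ _ => erefl)).
have [-> _] : eta N = 0 /\ derive1 eta N = 0 by apply: hN; exact: ler_norm.
have [-> _] : eta (- N) = 0 /\ derive1 eta (- N) = 0.
  by apply: hN; rewrite normrN; exact: ler_norm.
by rewrite !mulr0 subrr sub0r.
Qed.

Lemma smoothL1_weak_derivn j f : smoothL1 f -> is_weak_derivn j f f^`(j).
Proof.
elim: j f => [|j IH] f sf eta te; first by rewrite expr0 mul1r.
rewrite derive1nS integration_by_parts_test//; last exact: test_derive1n.
by rewrite IH//; [rewrite -derive1Sn exprS mulN1r mulNr|exact: smoothL1_derive1].
Qed.

Lemma smoothL1_Winf1 f : smoothL1 f -> Winf1 f.
Proof.
move=> sf; split; first by apply: derivable_continuousT => x; case: (sf 0%N).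
move=> k; split; first by case: (sf 0%N).
by move=> j _; exists f^`(j); [case: (sf j)|exact: smoothL1_weak_derivn].
Qed.

(** The representative picked by [weak_derivn] agrees almost everywhere with the classical
    derivative, so the choice does not affect the integrals. *)
Lemma sobolev_normE k f : smoothL1 f ->
  sobolev_norm k f = \sum_(j < k.+1) L1norm (derive1n j f).
Proof.
move=> sf; apply: eq_bigr => j _.
have Ij : integrable_fun f^`(j) by case: (sf j).
have [Ig wg] : integrable_fun (weak_derivn j f) /\ is_weak_derivn j f (weak_derivn j f).
  rewrite /weak_derivn; case: xgetP => [g -> //|/(_ f^`(j)) []].
  by split => //; exact: smoothL1_weak_derivn.
apply: ae_eq_Rintegral.
- by apply: integrable_fun_measurable; exact: integrable_fun_norm.
- by apply: integrable_fun_measurable; exact: integrable_fun_norm.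
have := weak_derivn_unique Ig Ij wg (@smoothL1_weak_derivn j f sf).
by apply: ae_imply => x ->.
Qed.

End WeakDerivative.

(** * The algebra of smooth functions with integrable derivatives *)

Section SobolevAlgebra.
Context {R : realType}.
Implicit Types (f g u v : R -> R) (x y c t : R) (a : nat -> R -> R).
Local Notation mu := (@lebesgue_measure R).

(** A finite-order version of [smoothL1], recursive through [derive1]: membership of products and
    composites is proved by induction on [k], since their derivatives are again built from products
    and composites. *)
Fixpoint L1reg (k : nat) f : Prop :=
  [/\ continuous f, integrable_fun f &
   if k is k'.+1 then (forall x, derivable f x 1) /\ L1reg k' (derive1 f) else True].

Lemma L1reg_continuous k f : L1reg k f -> continuous f.
Proof. by case: k => [|k] []. Qed.

Lemma L1reg_integrable k f : L1reg k f -> integrable_fun f.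
Proof. by case: k => [|k] []. Qed.

Lemma smoothL1P f : smoothL1 f <-> forall k, L1reg k f.
Proof.
split=> [sf k|].
  elim: k f sf => [|k IH] f sf; have [df If] := sf 0%N.
    by split => //; exact: derivable_continuousT.
  by split => //; [exact: derivable_continuousT|split => //; exact/IH/smoothL1_derive1].
move=> rf n; elim: n f rf => [|n IH] f rf; first by have [_ If [df _]] := rf 1%N.
by rewrite derive1Sn; apply: IH => k; have [_ _ []] := rf k.+1.
Qed.

Lemma smoothL1_continuous f : smoothL1 f -> continuous f.
Proof. by move=> /smoothL1P/(_ 0%N)/L1reg_continuous. Qed.

Lemma smoothL1_integrable f : smoothL1 f -> integrable_fun f.
Proof. by move=> /(_ 0%N)[]. Qed.

Lemma smoothL1_derivable f x : smoothL1 f -> derivable f x 1.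
Proof. by move=> /(_ 0%N)[]. Qed.

Lemma smoothL1_is_derive f x : smoothL1 f -> is_derive x (1 : R) f (f^`() x).
Proof. by move=> sf; exact/derivable_is_derive1/smoothL1_derivable. Qed.

Lemma smoothL1_measurable f : smoothL1 f -> measurable_fun setT f.
Proof. by move=> sf; apply: continuous_measurableT; exact: smoothL1_continuous. Qed.

Lemma smoothL1_sup f x : smoothL1 f -> `|f x| <= L1norm f^`().
Proof.
move=> sf; have sf' := smoothL1_derive1 sf; apply: le_sup_L1norm.
- by move=> y; exact: smoothL1_derivable.
- exact: smoothL1_continuous.
- exact: smoothL1_integrable.
- exact: smoothL1_integrable.
Qed.

Lemma L1regW k f : L1reg k.+1 f -> L1reg k f.
Proof.
elim: k f => [|k IH] f; first by case.
by move=> [cf If [df rf]]; split => //; split => //; exact: IH.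
Qed.

Lemma L1regD k f g : L1reg k f -> L1reg k g -> L1reg k (fun x => f x + g x).
Proof.
elim: k f g => [|k IH] f g; move=> [cf If Hf] [cg Ig Hg]; split.
1,4: by move=> x; apply: cvgD; [exact: cf|exact: cg].
1,3: exact: integrable_funD.
  by [].
case: Hf Hg => df rf [dg rg].
have dfg x := is_derive1D (derivable_is_derive1 (df x)) (derivable_is_derive1 (dg x)).
by rewrite (derive1_is_derive dfg); split; [move=> x; case: (dfg x)|exact: IH].
Qed.

Lemma L1regZ k c f : L1reg k f -> L1reg k (fun x => c * f x).
Proof.
elim: k f => [|k IH] f; move=> [cf If Hf]; split.
1,4: by move=> x; apply: cvgM; [exact: cvg_cst|exact: cf].
1,3: exact: integrable_funZ.
  by [].
case: Hf => df rf.
have dfg x := is_derive1Z c (derivable_is_derive1 (df x)).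
by rewrite (derive1_is_derive dfg); split; [move=> x; case: (dfg x)|exact: IH].
Qed.

Lemma L1regM_integrable k f g : L1reg k.+1 f -> continuous g ->
  integrable_fun g -> integrable_fun (fun x => f x * g x).
Proof.
move=> [cf If [df rf]] cg Ig.
have cf' := L1reg_continuous rf; have If' := L1reg_integrable rf.
apply: (@le_integrable_fun _ (L1norm f^`()) _ g) => //.
  by apply: measurable_funM; exact: continuous_measurableT.
by move=> x; rewrite normrM ler_wpM2r//; exact: (le_sup_L1norm x df cf' If If').
Qed.

(** One factor is bounded by the L^1 norm of its derivative, so it must have one order more; the
    Leibniz rule preserves this gap of one in both terms. *)
Lemma L1regM k f g : L1reg k.+1 f -> L1reg k g -> L1reg k (fun x => f x * g x).
Proof.
elim: k f g => [|k IH] f g; move=> [cf If [df rf]] [cg Ig Hg]; split.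
1,4: by move=> x; apply: cvgM; [exact: cf|exact: cg].
- by apply: (@L1regM_integrable 0); [split|..].
- by [].
- by apply: (@L1regM_integrable k.+1); [split|..].
case: Hg => dg rg.
have dfg x := is_derive1M (derivable_is_derive1 (df x)) (derivable_is_derive1 (dg x)).
rewrite (derive1_is_derive dfg); split; first by move=> x; case: (dfg x).
have hf : L1reg k.+1 f by split => //; split => //; exact: L1regW.
have hg : L1reg k.+1 g by split.
by apply: L1regD; apply: IH => //; exact: L1regW.
Qed.

Lemma smoothL1D f g : smoothL1 f -> smoothL1 g -> smoothL1 (fun x => f x + g x).
Proof.
move=> /smoothL1P rf /smoothL1P rg; apply/smoothL1P => k; exact: L1regD.
Qed.

Lemma smoothL1Z c f : smoothL1 f -> smoothL1 (fun x => c * f x).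
Proof. by move=> /smoothL1P rf; apply/smoothL1P => k; exact: L1regZ. Qed.

Lemma smoothL1M f g : smoothL1 f -> smoothL1 g -> smoothL1 (fun x => f x * g x).
Proof.
by move=> /smoothL1P rf /smoothL1P rg; apply/smoothL1P => k; exact: L1regM.
Qed.

Lemma smoothL1B f g : smoothL1 f -> smoothL1 g -> smoothL1 (fun x => f x - g x).
Proof.
move=> sf /(smoothL1Z (-1)) sg; have := smoothL1D sf sg.
by under eq_fun do rewrite mulN1r.
Qed.

Lemma derive1D f g : smoothL1 f -> smoothL1 g ->
  derive1 (fun x => f x + g x) = (fun x => derive1 f x + derive1 g x).
Proof.
move=> sf sg; apply: derive1_is_derive => x.
by apply: is_derive1D; exact: smoothL1_is_derive.
Qed.

Lemma derive1B f g : smoothL1 f -> smoothL1 g ->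
  derive1 (fun x => f x - g x) = (fun x => derive1 f x - derive1 g x).
Proof.
move=> sf sg; apply: derive1_is_derive => x.
by apply: is_derive1B; exact: smoothL1_is_derive.
Qed.

Lemma derive1Z c f : smoothL1 f ->
  derive1 (fun x => c * f x) = (fun x => c * derive1 f x).
Proof.
move=> sf; apply: derive1_is_derive => x.
by apply: is_derive1Z; exact: smoothL1_is_derive.
Qed.

Lemma derive1M f g : smoothL1 f -> smoothL1 g ->
  derive1 (fun x => f x * g x) = (fun x => derive1 f x * g x + f x * derive1 g x).
Proof.
move=> sf sg; apply: derive1_is_derive => x.
by apply: is_derive1M; exact: smoothL1_is_derive.
Qed.

(** Equal to [sobolev_norm] on [smoothL1] functions, by [sobolev_wnorm], but free of the choice of
    weak derivatives and recursive in the shape of the inductions that follow. *)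
Fixpoint wnorm (m : nat) f : R :=
  L1norm f + if m is m'.+1 then wnorm m' (derive1 f) else 0.

Lemma wnorm_ge0 m f : 0 <= wnorm m f.
Proof. by elim: m f => [|m IH] f; rewrite addr_ge0 ?L1norm_ge0. Qed.

Lemma wnorm_leS m f : wnorm m f <= wnorm m.+1 f.
Proof.
elim: m f => [|m IH] f; rewrite /= lerD2l; last exact: IH.
by rewrite addr_ge0 ?L1norm_ge0.
Qed.

Lemma wnorm_le m n f : (m <= n)%N -> wnorm m f <= wnorm n f.
Proof.
move=> mn; rewrite -(subnKC mn); elim: (n - m)%N => [|k IH]; first by rewrite addn0.
by rewrite addnS (le_trans IH)// wnorm_leS.
Qed.

Lemma L1norm_wnorm m f : L1norm f <= wnorm m f.
Proof. by apply: (le_trans _ (wnorm_le f (leq0n m))); rewrite /= addr0. Qed.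

Lemma wnorm_derive1 m f : wnorm m f^`() <= wnorm m.+1 f.
Proof. by rewrite /= lerDr L1norm_ge0. Qed.

Lemma wnorm_sup m f x : smoothL1 f -> `|f x| <= wnorm m.+1 f.
Proof.
move=> sf; apply: (le_trans (smoothL1_sup x sf)).
exact: le_trans (L1norm_wnorm m _) (wnorm_derive1 _ _).
Qed.

Lemma sobolev_wnorm m f : smoothL1 f -> sobolev_norm m f = wnorm m f.
Proof.
move=> sf; rewrite sobolev_normE//.
elim: m f sf => [|m IH] f sf; first by rewrite big_ord_recl big_ord0.
rewrite big_ord_recl /= -IH; last exact: smoothL1_derive1.
by congr (_ + _); apply: eq_bigr => j _; rewrite -derive1Sn.
Qed.

Lemma wnormD m f g : smoothL1 f -> smoothL1 g ->
  wnorm m (fun x => f x + g x) <= wnorm m f + wnorm m g.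
Proof.
elim: m f g => [|m IH] f g sf sg /=.
  by rewrite !addr0; apply: L1normD; exact: smoothL1_integrable.
rewrite addrACA lerD//; first by apply: L1normD; exact: smoothL1_integrable.
by rewrite derive1D//; apply: IH; exact: smoothL1_derive1.
Qed.

Lemma wnormZ m c f : smoothL1 f -> wnorm m (fun x => c * f x) = `|c| * wnorm m f.
Proof.
elim: m f => [|m IH] f sf /=.
  by rewrite !addr0 L1normZ//; exact: smoothL1_integrable.
rewrite L1normZ; last exact: smoothL1_integrable.
by rewrite derive1Z// IH ?mulrDr//; exact: smoothL1_derive1.
Qed.

(** The supremum of [f] costs one derivative, whence the order [m.+1] on the first factor only. *)
Lemma wnormM m : exists2 C, 0 <= C & forall f g, smoothL1 f -> smoothL1 g ->
  wnorm m (fun x => f x * g x) <= C * wnorm m.+1 f * wnorm m g.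
Proof.
have H f g : smoothL1 f -> smoothL1 g ->
    L1norm (fun x => f x * g x) <= wnorm 1 f * wnorm 0 g.
  move=> sf sg; rewrite [wnorm 0 g]/= addr0; apply: le_L1norm.
  - exact: smoothL1_integrable.
  - by apply: smoothL1_measurable; exact: smoothL1M.
  - by move=> x; rewrite normrM ler_wpM2r// wnorm_sup.
elim: m => [|m [C C0 IH]].
  by exists 1 => // f g sf sg; rewrite mul1r /= addr0; exact: H.
(* The [1] pays for the undifferentiated product, each [C] for one term of the Leibniz rule. *)
exists (1 + C + C) => [|f g sf sg]; first by rewrite !addr_ge0.
rewrite [leLHS]/= !mulrDl mul1r -addrA lerD//.
  by apply: (le_trans (H _ _ sf sg)); rewrite ler_pM ?wnorm_ge0// wnorm_le.
have sf' := smoothL1_derive1 sf; have sg' := smoothL1_derive1 sg.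
rewrite derive1M//; apply: (le_trans (wnormD _ _ _)); [exact: smoothL1M..|].
apply: lerD.
  apply: (le_trans (IH _ _ sf' sg)).
  by rewrite ler_pM ?mulr_ge0 ?wnorm_ge0 ?ler_wpM2l ?wnorm_derive1 ?wnorm_leS.
apply: (le_trans (IH _ _ sf sg')).
by rewrite ler_pM ?mulr_ge0 ?wnorm_ge0 ?ler_wpM2l ?wnorm_derive1 ?wnorm_leS.
Qed.

End SobolevAlgebra.

(** * Superposition operators *)

Section Superposition.
Context {R : realType}.
Implicit Types (f g h u v w : R -> R) (x y c s t lo hi : R) (a : nat -> R -> R).

(** An outer function is carried together with all its derivatives on the half-line, so that the
    induction on the order can pass to the shifted sequence. *)
Definition derivative_seq c a :=
  forall n s, - c < s -> is_derive s (1 : R) (a n) (a n.+1 s).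

Lemma derivative_seqS c a : derivative_seq c a -> derivative_seq c (fun n => a n.+1).
Proof. by move=> da n s; exact: da. Qed.

Lemma derivative_seq_within c a n lo hi : derivative_seq c a -> - c < lo ->
  {within `[lo, hi], continuous (a n)}.
Proof.
move=> da clo; apply: derivable_within_continuous => s; rewrite in_itv/= => /andP[los _].
by have [] := da n s (lt_le_trans clo los).
Qed.

Lemma derivative_seq_bounded c a n lo hi : derivative_seq c a -> - c < lo -> lo <= hi ->
  exists2 K, 0 <= K & forall s, lo <= s <= hi -> `|a n s| <= K.
Proof.
move=> da clo lohi.
have cn : {within `[lo, hi], continuous (fun s => `|a n s|)}.
  by move=> s; apply: (@cvg_norm _ R); exact: (derivative_seq_within da clo).
have [s0 _ h] := EVT_max lohi cn.
by exists `|a n s0| => // s slh; apply: h; rewrite in_itv.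
Qed.

(** The intermediate point is also kept within [|t - s|] of [s]: the Taylor estimate compares
    [a n.+1] at these two points. *)
Lemma derivative_seq_mvt c a n lo hi s t : derivative_seq c a -> - c < lo ->
  lo <= s <= hi -> lo <= t <= hi -> exists2 z, (lo <= z <= hi /\ `|z - s| <= `|t - s|) &
  a n t - a n s = a n.+1 z * (t - s).
Proof.
move=> da clo; have H p q : lo <= p <= hi -> lo <= q <= hi -> p <= q ->
    exists2 z, p <= z <= q & a n q - a n p = a n.+1 z * (q - p).
  move=> /andP[lop phi] /andP[loq qhi] pq.
  have [z|//|z zpq e] := @MVT_segment R (a n) (a n.+1) p q pq.
  - rewrite in_itv/= => /andP[pz zq]; apply: da.
    exact: lt_trans (le_lt_trans lop pz).
  - apply: (@derivative_seq_within c) => //; exact: lt_le_trans lop.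
  - by exists z => //; move: zpq; rewrite in_itv.
move=> slh tlh; have [st|/ltW ts] := leP s t.
  have [z /andP[sz zt] e] := H _ _ slh tlh st; exists z => //; split.
    by case/andP: slh => l1 h1; case/andP: tlh => l2 h2; apply/andP; split; lra.
  by rewrite !ger0_norm ?subr_ge0// lerD2r.
have [z /andP[tz zs] e] := H _ _ tlh slh ts; exists z.
  split.
    by case/andP: slh => l1 h1; case/andP: tlh => l2 h2; apply/andP; split; lra.
  by rewrite ![`|_ - s|]distrC !ger0_norm ?subr_ge0// lerD2l lerN2.
by rewrite -opprB e -mulrN opprB.
Qed.

Lemma derivative_seq_lip c a n lo hi : derivative_seq c a -> - c < lo -> lo <= hi ->
  exists2 K, 0 <= K & forall s t, lo <= s <= hi -> lo <= t <= hi ->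
    `|a n t - a n s| <= K * `|t - s|.
Proof.
move=> da clo lohi.
have [K K0 hK] := derivative_seq_bounded n.+1 da clo lohi.
exists K => // s t slh tlh.
have [z [zlh _] ->] := derivative_seq_mvt n da clo slh tlh.
by rewrite normrM ler_wpM2r// hK.
Qed.

Lemma derivative_seq_taylor c a n lo hi : derivative_seq c a -> - c < lo -> lo <= hi ->
  exists2 K, 0 <= K & forall s t, lo <= s <= hi -> lo <= t <= hi ->
    `|a n t - a n s - a n.+1 s * (t - s)| <= K * `|t - s| ^+ 2.
Proof.
move=> da clo lohi.
have [K K0 hK] := derivative_seq_lip n.+1 da clo lohi.
exists K => // s t slh tlh.
have [z [zlh zs] ->] := derivative_seq_mvt n da clo slh tlh.
rewrite -mulrBl normrM expr2 mulrA ler_wpM2r//.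
by apply: (le_trans (hK _ _ slh zlh)); rewrite ler_wpM2l.
Qed.

Section Range.
Variables (c lo hi : R) (clo : - c < lo) (lo0 : lo <= 0) (hi0 : 0 <= hi).

Let lohi : lo <= hi. Proof. exact: le_trans hi0. Qed.

(** The interval [[lo, hi]] is a compact part of the domain of the outer function. It contains [0],
    so the Lipschitz bound on it controls [a n (u x) - a n 0] by [|u x|]. *)
Definition ranges_in u := forall x, lo <= u x <= hi.

Lemma is_derive_superposition a n u x : derivative_seq c a -> smoothL1 u ->
  ranges_in u ->
  is_derive x (1 : R) (fun y => a n (u y)) (a n.+1 (u x) * derive1 u x).
Proof.
move=> da su ru; apply: (@is_derive1_comp _ (a n) u).
  by apply: da; case/andP: (ru x) => + _; exact: lt_le_trans.
exact: smoothL1_is_derive.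
Qed.

(** Subtracting the value at [0] makes the composite integrable, by the Lipschitz bound. Its
    derivative is treated by the induction hypothesis for the shifted sequence. *)
Lemma L1reg_superposition k a u : derivative_seq c a -> smoothL1 u -> ranges_in u ->
  L1reg k (fun x => a 0%N (u x) - a 0%N 0).
Proof.
move=> da su ru; elim: k a da => [|k IH] a da.
all: have d x := is_derive1B (is_derive_superposition 0 x da su ru) (is_derive1_cst (a 0%N 0) x).
all: have ca : continuous (fun x => a 0%N (u x) - a 0%N 0) by
  apply: derivable_continuousT => x; case: (d x).
all: split => //.
1,2: have [K K0 hK] := derivative_seq_lip 0 da clo lohi;
  apply: (@le_integrable_fun _ K _ u);
  [exact: continuous_measurableT|move=> x|exact: smoothL1_integrable].
1,2: by rewrite -[X in _ <= K * `|X|]subr0; apply: hK => //; rewrite lo0.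
split; first by move=> x; case: (d x).
rewrite (derive1_is_derive d).
(* The factor [a 1 \o u] is not integrable in general and is recentred at [0]; the derivative of
   [u], regular to all orders, supplies the extra order that [L1regM] asks of one factor. *)
rewrite (_ : (fun x => _) = (fun x => (derive1 u x * (a 1%N (u x) - a 1%N 0)) +
    a 1%N 0 * derive1 u x)); last by apply/funext => x; ring.
have /smoothL1P su' := smoothL1_derive1 su.
apply: L1regD; last exact: L1regZ.
by apply: L1regM => //; apply: (IH (fun n => a n.+1)); exact: derivative_seqS.
Qed.

Lemma smoothL1_superposition0 a u : derivative_seq c a -> smoothL1 u -> ranges_in u ->
  smoothL1 (fun x => a 0%N (u x) - a 0%N 0).
Proof. by move=> da su ru; apply/smoothL1P => k; exact: L1reg_superposition. Qed.

Lemma derivative_seq_shift a n : derivative_seq c a ->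
  derivative_seq c (fun m => a (n + m)%N).
Proof. by move=> da m s cs; rewrite addnS; exact: da. Qed.

Lemma smoothL1_superposition a n u : derivative_seq c a -> smoothL1 u -> ranges_in u ->
  smoothL1 (fun x => a n (u x) - a n 0).
Proof.
move=> da su ru; have := smoothL1_superposition0 (derivative_seq_shift n da) su ru.
by rewrite addn0.
Qed.

Lemma superpositionM a n u w :
  (fun x => a n (u x) * w x) = (fun x => (a n (u x) - a n 0) * w x + a n 0 * w x).
Proof. by apply/funext => x; ring. Qed.

Lemma smoothL1_superpositionM a n u w : derivative_seq c a -> smoothL1 u ->
  ranges_in u -> smoothL1 w -> smoothL1 (fun x => a n (u x) * w x).
Proof.
move=> da su ru sw; rewrite superpositionM.
apply: smoothL1D; last exact: smoothL1Z.
by apply: smoothL1M => //; exact: smoothL1_superposition.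
Qed.

Lemma smoothL1_superpositionB a n u v : derivative_seq c a -> smoothL1 u ->
  ranges_in u -> smoothL1 v -> ranges_in v ->
  smoothL1 (fun x => a n (v x) - a n (u x)).
Proof.
move=> da su ru sv rv.
have := smoothL1B (smoothL1_superposition n da sv rv) (smoothL1_superposition n da su ru).
by congr smoothL1; apply/funext => x; ring.
Qed.

Lemma wnorm_superpositionM m a n u : derivative_seq c a -> smoothL1 u -> ranges_in u ->
  exists2 K, 0 <= K & forall w, smoothL1 w ->
    wnorm m (fun x => a n (u x) * w x) <= K * wnorm m w.
Proof.
move=> da su ru; have sa := smoothL1_superposition n da su ru.
have [C C0 hC] := @wnormM R m.
exists (C * wnorm m.+1 (fun x => a n (u x) - a n 0) + `|a n 0|) => [|w sw].
  by rewrite addr_ge0// mulr_ge0// wnorm_ge0.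
rewrite superpositionM; apply: (le_trans (wnormD _ _ _)).
- exact: smoothL1M.
- exact: smoothL1Z.
- by rewrite mulrDl wnormZ// lerD2r hC.
Qed.

(** The derivative of the difference is [v' (a 1 v - a 1 u) + a 1 u (v' - u')]. The first term is
    bounded by induction on the shifted sequence, the second because [u] is fixed. The bound [M] is
    one order above the estimate since the product estimate differentiates [v'] once more. *)
Lemma superposition_lipschitz m M u : 0 <= M -> smoothL1 u -> ranges_in u ->
  forall a, derivative_seq c a -> exists2 K, 0 <= K & forall v, smoothL1 v ->
    ranges_in v -> wnorm m.+1 v <= M ->
    wnorm m (fun x => a 0%N (v x) - a 0%N (u x)) <= K * wnorm m (fun x => v x - u x).
Proof.
move=> M0 su ru.
have base a : derivative_seq c a -> exists2 K, 0 <= K & forall v, smoothL1 v ->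
    ranges_in v ->
    L1norm (fun x => a 0%N (v x) - a 0%N (u x)) <= K * L1norm (fun x => v x - u x).
  move=> da; have [K K0 hK] := derivative_seq_lip 0 da clo lohi.
  exists K => // v sv rv; apply: le_L1norm.
  - by apply: smoothL1_integrable; exact: smoothL1B.
  - by apply: smoothL1_measurable; exact: smoothL1_superpositionB.
  - by move=> x; exact: hK.
elim: m => [|m IH] a da.
  have [K K0 hK] := base a da; exists K => // v sv rv _.
  by rewrite /= !addr0; exact: hK.
have [K K0 hK] := base a da.
have [K1 K10 hK1] := IH _ (derivative_seqS da).
have [K2 K20 hK2] := wnorm_superpositionM m 1 da su ru.
have [C C0 hC] := @wnormM R m.
exists (K + C * M * K1 + K2); first by rewrite !addr_ge0// !mulr_ge0.
move=> v sv rv vM.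
have sv' := smoothL1_derive1 sv; have su' := smoothL1_derive1 su.
have svu := smoothL1B sv su.
rewrite [leLHS]/= (derive1_is_derive (fun x =>
  is_derive1B (is_derive_superposition 0 x da sv rv) (is_derive_superposition 0 x da su ru))).
rewrite (_ : (fun x => _ - _ * _) = (fun x => derive1 v x * (a 1%N (v x) - a 1%N (u x)) +
    a 1%N (u x) * (derive1 v x - derive1 u x))); last by apply/funext => x; ring.
rewrite !mulrDl -addrA lerD//.
  by apply: (le_trans (hK _ sv rv)); rewrite ler_wpM2l// L1norm_wnorm.
apply: (le_trans (wnormD _ _ _)).
- by apply: smoothL1M => //; exact: smoothL1_superpositionB.
- by apply: smoothL1_superpositionM => //; exact: smoothL1B.
apply: lerD.
  apply: (le_trans (hC _ _ _ _)) => //; first exact: smoothL1_superpositionB.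
  rewrite -!mulrA ler_wpM2l// ler_pM ?wnorm_ge0//.
    exact: le_trans (wnorm_derive1 _ _) vM.
  apply: (le_trans (hK1 _ sv rv _)); first exact: le_trans (wnorm_leS _ _) vM.
  by rewrite ler_wpM2l// wnorm_leS.
apply: (le_trans (hK2 _ _)); first exact: smoothL1B.
by rewrite ler_wpM2l// -derive1B// wnorm_derive1.
Qed.

(** At order zero the second-order Taylor remainder is divided by [t]. One order up, the derivative
    of the error is [u'] times the error of the shifted sequence plus [h'] times [a 1 v - a 1 u],
    with [v = u + t h]; the latter is O(t) by the Lipschitz estimate. *)
Lemma superposition_quotient m u h : smoothL1 u -> ranges_in u -> smoothL1 h ->
  forall a, derivative_seq c a -> exists2 K, 0 <= K & forall t, t != 0 -> `|t| <= 1 ->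
    ranges_in (fun x => u x + t * h x) ->
    wnorm m (fun x => t^-1 * (a 0%N (u x + t * h x) - a 0%N (u x)) - a 1%N (u x) * h x)
      <= K * `|t|.
Proof.
move=> su ru sh.
have sth t : smoothL1 (fun x => u x + t * h x) by apply: smoothL1D => //; exact: smoothL1Z.
have sq a t : derivative_seq c a -> ranges_in (fun x => u x + t * h x) ->
    smoothL1 (fun x => t^-1 * (a 0%N (u x + t * h x) - a 0%N (u x)) - a 1%N (u x) * h x).
  move=> da rt; apply: smoothL1B; last exact: smoothL1_superpositionM.
  apply: smoothL1Z; exact: (smoothL1_superpositionB 0 da su ru (sth t) rt).
have base a : derivative_seq c a -> exists2 K, 0 <= K & forall t, t != 0 -> `|t| <= 1 ->
    ranges_in (fun x => u x + t * h x) ->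
    L1norm (fun x => t^-1 * (a 0%N (u x + t * h x) - a 0%N (u x)) - a 1%N (u x) * h x)
      <= K * `|t|.
  move=> da; have [K K0 hK] := derivative_seq_taylor 0 da clo lohi.
  exists (K * wnorm 1 h * L1norm h); first by rewrite !mulr_ge0 ?wnorm_ge0 ?L1norm_ge0.
  move=> t t0 t1 rt; rewrite mulrAC; apply: le_L1norm.
  - exact: smoothL1_integrable.
  - by apply: smoothL1_measurable; exact: sq.
  move=> x.
  rewrite (_ : _ - _ = t^-1 * (a 0%N (u x + t * h x) - a 0%N (u x) -
    a 1%N (u x) * ((u x + t * h x) - u x))); last by field.
  rewrite normrM normfV ler_pdivrMl ?normr_gt0//.
  apply: (le_trans (hK _ _ (ru x) (rt x))).
  rewrite addrAC subrr add0r normrM exprMn.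
  have := wnorm_sup 0 x sh; move: (wnorm 1 h) => W hW.
  rewrite (_ : `|t| * _ = K * (`|t| ^+ 2 * (W * `|h x|))); last by ring.
  by rewrite ler_wpM2l// ler_wpM2l ?exprn_ge0// expr2 ler_wpM2r.
elim: m => [|m IH] a da.
  have [K K0 hK] := base a da; exists K => // t t0 t1 rt.
  by rewrite /= addr0; exact: hK.
have [K K0 hK] := base a da.
have [K1 K10 hK1] := IH _ (derivative_seqS da).
(* Bounds [u + t h] in the seminorm for every [t] with [|t| <= 1], so that one Lipschitz constant
   serves them all. *)
pose M := wnorm m.+1 u + wnorm m.+1 h.
have M0 : 0 <= M by rewrite addr_ge0 ?wnorm_ge0.
have [K2 K20 hK2] := superposition_lipschitz m M0 su ru (derivative_seqS da).
have [C C0 hC] := @wnormM R m.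
have sh' := smoothL1_derive1 sh; have su' := smoothL1_derive1 su.
exists (K + C * wnorm m.+1 u^`() * K1 + C * wnorm m.+1 h^`() * (K2 * wnorm m h)).
  by rewrite !addr_ge0// !mulr_ge0// wnorm_ge0.
move=> t t0 t1 rt.
pose v x := u x + t * h x.
have sv : smoothL1 v := sth t.
have dv : v^`() = (fun x => derive1 u x + t * derive1 h x).
  by rewrite /v derive1D ?derive1Z//; exact: smoothL1Z.
rewrite [leLHS]/= (_ : derive1 _ = (fun x =>
  derive1 u x * (t^-1 * (a 1%N (v x) - a 1%N (u x)) - a 2%N (u x) * h x) +
  derive1 h x * (a 1%N (v x) - a 1%N (u x)))); last first.
  apply: derive1_is_derive => x.
  have d1 := is_derive_superposition 0 x da sv rt.
  have d2 := is_derive_superposition 0 x da su ru.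
  have d3 := is_derive_superposition 1 x da su ru.
  have d4 := is_derive1M d3 (smoothL1_is_derive x sh).
  apply: is_derive1_eq (is_derive1B (is_derive1Z t^-1 (is_derive1B d1 d2)) d4) => //.
  by rewrite dv; field.
have sB : smoothL1 (fun x => a 1%N (v x) - a 1%N (u x)) by exact: smoothL1_superpositionB.
have sQ := sq _ _ (derivative_seqS da) rt.
rewrite !mulrDl -addrA lerD//; first exact: hK.
apply: (le_trans (wnormD _ _ _)); [exact: smoothL1M..|].
apply: lerD.
  apply: (le_trans (hC _ _ _ _)) => //.
  by rewrite -!mulrA ler_wpM2l// ler_wpM2l ?wnorm_ge0//; exact: hK1.
apply: (le_trans (hC _ _ _ _)) => //.
rewrite -!mulrA ler_wpM2l// ler_wpM2l ?wnorm_ge0//.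
apply: (le_trans (hK2 v sv rt _)).
  apply: (le_trans (wnormD _ _ _)) => //; first exact: smoothL1Z.
  by rewrite lerD2l wnormZ// ler_piMl ?wnorm_ge0.
rewrite ler_wpM2l// (_ : (fun x => _) = (fun x => t * h x)).
  by rewrite wnormZ// mulrC.
by apply/funext => x; rewrite /v; ring.
Qed.

End Range.

End Superposition.

(** * Decay at infinity and the uniform gap below *)

Section Decay.
Context {R : realType}.
Implicit Types (f g h u v w : R -> R) (x y c e : R).
Local Notation mu := (@lebesgue_measure R).

Definition far (N : R) : set R := [set t | N <= `|t|].

Lemma measurable_far (N : R) : measurable (far N).
Proof.
rewrite (_ : far N = `]-oo, - N] `|` `[N, +oo[); first exact: measurableU.
apply/seteqP; split => t; rewrite /far/= !in_itv/= andbT ler_normr lerNr.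
  by move=> /orP[->|->]; [right|left].
by move=> [->|->]; rewrite ?orbT.
Qed.

(** The restrictions of [|f|] to the sets [far n.+1] tend to [0] pointwise and are dominated by
    [|f|]. *)
Lemma integrable_tail f e : integrable_fun f -> 0 < e ->
  exists2 N : R, 0 < N & \int[mu]_(t in far N) `|f t| <= e.
Proof.
move=> If e0; have mf := integrable_fun_measurable If.
have mn : measurable_fun setT (fun t => `|f t|) by exact: measurableT_comp.
have cvg0 : (\int[mu]_t (((fun t => `|f t|) \_ (far n.+1%:R)) t)%:E)%E @[n --> \oo]
    --> (\int[mu]_(t in setT) (cst 0%R t)%:E)%E.
  apply: (@dominated_cvg _ _ _ mu setT _ _ _ (fun t => `|(f t)%:E|%E)) => //.
  - move=> n; apply/measurable_EFinP; apply/measurable_restrict => //.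
      exact: measurable_far.
    by rewrite setTI; exact: measurable_funTS.
  - move=> t _; apply: cvg_near_cst; near=> n; apply/eqP.
    rewrite patchE; case: ifPn => //; rewrite inE /far/= => tn; exfalso.
    move: tn; apply/negP; rewrite -ltNge.
    apply: (@lt_le_trans _ _ n%:R); last by rewrite ler_nat.
    by near: n; exact: nbhs_infty_gtr.
  - exact: integrable_abse.
  - move=> n t _; rewrite lee_fin; rewrite patchE; case: ifPn => _.
      by rewrite normr_id.
    by rewrite normr0.
have : \int[mu]_t ((fun t => `|f t|) \_ (far n.+1%:R)) t @[n --> \oo] --> 0.
  apply: fine_cvg; move: cvg0.
  by rewrite (_ : (\int[mu]_(t in setT) (cst 0%R t)%:E)%E = 0%:E) ?integral0.
move=> /cvgrPdist_le/(_ e e0)[n _ /(_ n (leqnn n))/=].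
rewrite sub0r normrN -Rintegral_mkcond => hn; exists n.+1%:R => //.
exact: le_trans (ler_norm _) hn.
Unshelve. all: by end_near. Qed.

Lemma Rintegral_le_subset f (A B : set R) : measurable A -> measurable B -> A `<=` B ->
  integrable_fun f -> \int[mu]_(x in A) `|f x| <= \int[mu]_(x in B) `|f x|.
Proof.
move=> mA mB AB If; rewrite Rintegral_mkcond [leRHS]Rintegral_mkcond.
have H C : measurable C -> mu.-integrable setT (EFin \o ((fun x => `|f x|) \_ C)).
  move=> mC; rewrite -restrict_EFin; apply/integrable_restrict => //=; rewrite setTI.
  by apply: integrableS (integrable_fun_norm If).
apply: le_Rintegral => //; [exact: H..|].
move=> x _; rewrite !patchE; case: ifPn => xA; last first.
  by case: ifPn => _; [exact: normr_ge0|exact: lexx].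
by rewrite ifT//; move: xA; rewrite !inE; exact: AB.
Qed.

(** Beyond [N], on either side, [u] oscillates by at most the tail integral of [|u'|], that is by at
    most [e]. A value larger than [e] would thus keep [|u|] away from [0] on a whole half-line,
    against integrability. *)
Lemma smoothL1_decay u e : smoothL1 u -> 0 < e ->
  exists2 N : R, 0 < N & forall x, N <= `|x| -> `|u x| <= e.
Proof.
move=> su e0; have su' := smoothL1_derive1 su.
have [N N0 hN] := integrable_tail (smoothL1_integrable su') e0.
exists N => // x Nx; rewrite leNgt; apply/negP => ux.
have key y : (forall t, (x <= t <= y) || (y <= t <= x) -> N <= `|t|) -> `|u x| - e <= `|u y|.
  move=> xy; rewrite lerBlDr -lerBlDl.
  apply: (@le_trans _ _ `|u x - u y|); first exact: lerB_dist.
  apply: (le_trans _ hN).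
  have cu' := smoothL1_continuous su'; have Iu' := smoothL1_integrable su'.
  have [le_xy|/ltW le_yx] := leP x y.
    rewrite distrC; apply: (le_trans (dist_le_Rintegral _ cu' Iu' le_xy)).
      by move=> z; exact: smoothL1_derivable.
    apply: Rintegral_le_subset => //; first exact: measurable_far.
    by move=> t /=; rewrite in_itv/= => xty; apply: xy; rewrite xty.
  apply: (le_trans (dist_le_Rintegral _ cu' Iu' le_yx)).
    by move=> z; exact: smoothL1_derivable.
  apply: Rintegral_le_subset => //; first exact: measurable_far.
  by move=> t /=; rewrite in_itv/= => xty; apply: xy; rewrite xty orbT.
have d0 : 0 < `|u x| - e by rewrite subr_gt0.
have [x0|x0] := leP 0 x.
  move: Nx; rewrite ger0_norm// => Nx.
  have [|y yN] := @integrable_norm_lt R u _ `[N, +oo[%R (smoothL1_integrable su) _ d0.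
    by rewrite lebesgue_measure_itv/= ltry.
  apply/negP; rewrite -leNgt; apply: key => t; move: yN; rewrite in_itv/= andbT => yN.
  move=> txy; apply: (le_trans _ (ler_norm t)).
  by case/orP : txy => /andP[t1 t2]; lra.
move: Nx; rewrite ltr0_norm// => Nx.
have [|y yN] := @integrable_norm_lt R u _ `]-oo, (- N)]%R (smoothL1_integrable su) _ d0.
  by rewrite lebesgue_measure_itv/= ltNyr.
apply/negP; rewrite -leNgt; apply: key => t; move: yN; rewrite in_itv/= => yN.
move=> txy; rewrite -normrN; apply: (le_trans _ (ler_norm (- t))).
by case/orP : txy => /andP[t1 t2]; lra.
Qed.

Lemma primitive_cvg0 f : integrable_fun f -> primitive f x @[x --> -oo] --> (0 : R).
Proof.
move=> If; apply/cvgrPdist_le => /= e e0.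
have [N N0 hN] := integrable_tail If e0.
near=> x; rewrite sub0r normrN.
apply: (@le_trans _ _ (\int[mu]_(t in `]-oo, x]) `|f t|)).
  by apply: le_normr_Rintegral => //; apply: integrableS If.
apply: (le_trans _ hN); apply: Rintegral_le_subset => //; first exact: measurable_far.
move=> t /=; rewrite in_itv/= /far/= => tx.
rewrite -normrN; apply: (le_trans _ (ler_norm (- t))).
rewrite lerNr (le_trans tx)//; near: x; exact: nbhs_ninfty_le.
Unshelve. all: by end_near. Qed.

(** Outside [[- N, N]] decay gives [u >= - (c / 2)], inside it the minimum is attained and exceeds
    [- c]. The margin [d] leaves room for perturbations of [u]. *)
Lemma smoothL1_bounds c u : 0 < c -> smoothL1 u -> (forall x, - c < u x) ->
  exists lo hi d, [/\ - c < lo, lo <= 0, 0 <= hi, 0 < d &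
    forall x, lo + d <= u x <= hi - d].
Proof.
move=> c0 su cu.
have [|N N0 hN] := @smoothL1_decay u (c / 2) su; first by rewrite divr_gt0.
have NN : - N <= N by rewrite ge0_cp// ltW.
have [z zN hz] := EVT_min NN (continuous_subspaceT (smoothL1_continuous su)).
pose l := Num.min (u z) (- (c / 2)).
have l1 : l <= u z by rewrite /l ge_min lexx.
have l2 : l <= - (c / 2) by rewrite /l ge_min lexx orbT.
have l3 : - c < l by rewrite /l lt_min cu/= ltrN2; lra.
(* [lo] is the midpoint of [- c] and the lower bound [l], and [d] is half of the gap between them,
   so that [lo + d = l]. *)
exists ((l - c) / 2), (wnorm 1 u + (l + c) / 2), ((l + c) / 2); split.
- lra.
- lra.
- by rewrite addr_ge0 ?wnorm_ge0//; lra.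
- lra.
move=> x; apply/andP; split; last first.
  by rewrite addrK (le_trans (ler_norm _))// wnorm_sup.
apply: (@le_trans _ _ l); first lra.
have [xN|Nx] := ltP `|x| N.
  apply: (le_trans l1); apply: hz; rewrite in_itv/=.
  by move: xN; rewrite ltr_norml => /andP[/ltW -> /ltW ->].
have := hN _ Nx; rewrite ler_norml => /andP[ux _]; lra.
Qed.

End Decay.

(** * Smoothness of superposition operators *)

Section JointlyLipschitz.
Context {R : realType} (c : R).
Local Notation E := (R -> R^o).
Implicit Types (f g h u v w : R -> R) (x y e t : R) (hs ks : seq E)
  (T : (R -> R) -> seq E -> R -> R) (a : nat -> R -> R).

Definition above u := smoothL1 u /\ forall x, - c < u x.

Definition directions n hs :=
  size hs = n /\ forall i, (i < n)%N -> smoothL1 (nth (0 : E) hs i).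

(** A quantitative form of the joint continuity demanded of the derivatives. One [rho] measures the
    change of the point and of all directions, and the constants may depend on the base point, which
    makes the property stable under products. *)
Definition jointly_lipschitz n T := forall u hs, above u -> directions n hs ->
  smoothL1 (T u hs) /\ forall m, exists N d K, [/\ 0 < d, 0 <= K &
    forall v ks (rho : R), above v -> directions n ks -> 0 <= rho -> rho <= d ->
      wnorm N (fun x => v x - u x) <= rho ->
      (forall i, (i < n)%N ->
        wnorm N (fun x => nth (0 : E) ks i x - nth (0 : E) hs i x) <= rho) ->
      wnorm m (fun x => T v ks x - T u hs x) <= K * rho].

Lemma jointly_lipschitzZ n T (b : R) : jointly_lipschitz n T ->
  jointly_lipschitz n (fun u hs x => b * T u hs x).
Proof.
move=> lT u hs au dh; have [sT hT] := lT u hs au dh; split; first exact: smoothL1Z.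
move=> m; have [N [d [K [d0 K0 hK]]]] := hT m.
exists N, d, (`|b| * K); split; rewrite ?mulr_ge0// => v ks rho av dk r0 rd vr kr.
have [sTv _] := lT v ks av dk.
rewrite (_ : (fun x => _) = (fun x => b * (T v ks x - T u hs x))).
  by rewrite wnormZ; [rewrite -mulrA ler_wpM2l// hK|exact: smoothL1B].
by apply/funext => x; rewrite mulrBr.
Qed.

Lemma jointly_lipschitzD n T1 T2 : jointly_lipschitz n T1 -> jointly_lipschitz n T2 ->
  jointly_lipschitz n (fun u hs x => T1 u hs x + T2 u hs x).
Proof.
move=> lT1 lT2 u hs au dh; have [sT1 hT1] := lT1 u hs au dh.
have [sT2 hT2] := lT2 u hs au dh; split; first exact: smoothL1D.
move=> m; have [N1 [d1 [K1 [d10 K10 hK1]]]] := hT1 m.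
have [N2 [d2 [K2 [d20 K20 hK2]]]] := hT2 m.
exists (maxn N1 N2), (Num.min d1 d2), (K1 + K2); split; rewrite ?addr_ge0//.
  by rewrite lt_min d10.
move=> v ks rho av dk r0; rewrite le_min => /andP[rd1 rd2] vr kr.
have [sTv1 _] := lT1 v ks av dk; have [sTv2 _] := lT2 v ks av dk.
rewrite (_ : (fun x => _) = (fun x => (T1 v ks x - T1 u hs x) + (T2 v ks x - T2 u hs x))).
  apply: (le_trans (wnormD _ _ _)); [exact: smoothL1B..|].
  rewrite mulrDl lerD//.
    apply: hK1 => //; first by apply: le_trans vr; rewrite wnorm_le// leq_maxl.
    by move=> i ni; apply: le_trans (kr i ni); rewrite wnorm_le// leq_maxl.
  apply: hK2 => //; first by apply: le_trans vr; rewrite wnorm_le// leq_maxr.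
  by move=> i ni; apply: le_trans (kr i ni); rewrite wnorm_le// leq_maxr.
by apply/funext => x; ring.
Qed.

Lemma jointly_lipschitzM n T1 T2 : jointly_lipschitz n T1 -> jointly_lipschitz n T2 ->
  jointly_lipschitz n (fun u hs x => T1 u hs x * T2 u hs x).
Proof.
move=> lT1 lT2 u hs au dh; have [sT1 hT1] := lT1 u hs au dh.
have [sT2 hT2] := lT2 u hs au dh; split; first exact: smoothL1M.
move=> m; have [N1 [d1 [K1 [d10 K10 hK1]]]] := hT1 m.+1.
have [N2 [d2 [K2 [d20 K20 hK2]]]] := hT2 m.+1.
have [C C0 hC] := @wnormM R m.
exists (maxn N1 N2), (Num.min d1 d2),
  (C * K1 * (wnorm m (T2 u hs) + K2 * d2) + C * wnorm m.+1 (T1 u hs) * K2); split.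
- by rewrite lt_min d10.
- have d20' := ltW d20.
  apply: addr_ge0; last by rewrite !mulr_ge0// wnorm_ge0.
  by rewrite mulr_ge0 ?addr_ge0 ?wnorm_ge0// mulr_ge0.
move=> v ks rho av dk r0; rewrite le_min => /andP[rd1 rd2] vr kr.
have [sTv1 _] := lT1 v ks av dk; have [sTv2 _] := lT2 v ks av dk.
have e1 : wnorm m.+1 (fun x => T1 v ks x - T1 u hs x) <= K1 * rho.
  apply: hK1 => //; first by apply: le_trans vr; rewrite wnorm_le// leq_maxl.
  by move=> i ni; apply: le_trans (kr i ni); rewrite wnorm_le// leq_maxl.
have e2 : wnorm m (fun x => T2 v ks x - T2 u hs x) <= K2 * rho.
  apply: (le_trans (wnorm_leS _ _)).
  apply: hK2 => //; first by apply: le_trans vr; rewrite wnorm_le// leq_maxr.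
  by move=> i ni; apply: le_trans (kr i ni); rewrite wnorm_le// leq_maxr.
(* The product is split with [T2] taken at the moving point, so [T2] must be bounded uniformly
   nearby; [rho <= d2] turns the Lipschitz bound into the constant [K2 * d2]. *)
have e3 : wnorm m (T2 v ks) <= wnorm m (T2 u hs) + K2 * d2.
  rewrite (_ : T2 v ks = (fun x => T2 u hs x + (T2 v ks x - T2 u hs x))).
    apply: (le_trans (wnormD _ _ _)) => //; first exact: smoothL1B.
    by rewrite lerD2l (le_trans e2)// ler_wpM2l.
  by apply/funext => x; ring.
rewrite (_ : (fun x => _) = (fun x => (T1 v ks x - T1 u hs x) * T2 v ks x +
    T1 u hs x * (T2 v ks x - T2 u hs x))); last by apply/funext => x; ring.
have sB1 := smoothL1B sTv1 sT1; have sB2 := smoothL1B sTv2 sT2.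
apply: (le_trans (wnormD _ _ _)); [exact: smoothL1M..|].
rewrite mulrDl lerD//.
  apply: (le_trans (hC _ _ _ _)) => //.
  rewrite [leRHS]mulrAC ler_pM ?mulr_ge0 ?wnorm_ge0//.
  by rewrite -mulrA ler_wpM2l.
apply: (le_trans (hC _ _ _ _)) => //.
by rewrite -[leRHS]mulrA ler_wpM2l// mulr_ge0// wnorm_ge0.
Qed.

Lemma jointly_lipschitz_nth n i : (i < n)%N ->
  jointly_lipschitz n (fun u hs => nth (0 : E) hs i).
Proof.
move=> ni u hs au [sh dh]; split; first exact: dh.
move=> m; exists m, 1, 1; split => // v ks rho av dk r0 r1 vr kr.
by rewrite mul1r kr.
Qed.

Lemma jointly_lipschitz_prod n k : (k < n)%N ->
  jointly_lipschitz n (fun u hs x => \prod_(i < k.+1) nth (0 : E) hs i x).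
Proof.
elim: k => [|k IH] kn.
  rewrite (_ : (fun u hs => _) = (fun _ hs => nth (0 : E) hs 0)).
    exact: jointly_lipschitz_nth.
  by apply/funext => u; apply/funext => hs; apply/funext => x;
    rewrite big_ord_recr big_ord0/= mul1r.
rewrite (_ : (fun u hs => _) = (fun u hs x =>
  (\prod_(i < k.+1) nth (0 : E) hs i x) * nth (0 : E) hs k.+1 x)).
  apply: (@jointly_lipschitzM n (fun _ hs x => \prod_(i < k.+1) nth (0 : E) hs i x)
    (fun _ hs => nth (0 : E) hs k.+1)); last exact: jointly_lipschitz_nth.
  by apply: IH; exact: ltnW.
by apply/funext => u; apply/funext => hs; apply/funext => x; rewrite big_ord_recr.
Qed.

Hypothesis c0 : 0 < c.

Lemma jointly_lipschitz_superposition n k a : derivative_seq c a ->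
  jointly_lipschitz n (fun u hs x => a k (u x) - a k 0).
Proof.
move=> da u hs [su cu] dh.
have [lo [hi [d [clo lo0 hi0 d0 ru]]]] := smoothL1_bounds c0 su cu.
have ru' : ranges_in lo hi u by move=> x; have := ru x; lra.
split; first exact: (smoothL1_superposition clo lo0 hi0 k da su ru').
move=> m; have M0 : 0 <= wnorm m.+1 u + d by rewrite addr_ge0 ?wnorm_ge0// ltW.
have [K K0 hK] := superposition_lipschitz clo lo0 hi0 m M0 su ru'
  (derivative_seq_shift k da).
exists m.+1, d, K; split => // v ks rho [sv cv] dk r0 rd vr kr.
have svu := smoothL1B sv su.
(* The seminorm [wnorm m.+1] dominates the supremum, so a perturbation of size at most [d] stays
   within the margin around the range of [u]. *)
have rv : ranges_in lo hi v.
  move=> x; have := wnorm_sup m x svu; have := ru x.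
  by rewrite ler_norml; lra.
rewrite (_ : (fun x => _) = (fun x => a (k + 0)%N (v x) - a (k + 0)%N (u x))).
  apply: (le_trans (hK v sv rv _)).
    rewrite (_ : v = (fun x => u x + (v x - u x))).
      by apply: (le_trans (wnormD _ _ _)) => //; rewrite lerD2l (le_trans vr).
    by apply/funext => x; ring.
  by rewrite ler_wpM2l// (le_trans (wnorm_leS _ _)).
by apply/funext => x; rewrite addn0; ring.
Qed.

(* The derivative of order [size hs] of [u |-> a 0 \o u] in the directions [hs]. *)
Definition superposition_derive a u hs : R -> R :=
  fun x => a (size hs) (u x) * \prod_(i < size hs) nth (0 : E) hs i x.

(** For [n > 0] the possibly nonzero constant [a n 0] is multiplied by directions, which makes it
    integrable. For [n = 0] the product is empty, and [a 0 0 = 0] takes over this role. *)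
Lemma jointly_lipschitz_superposition_derive n a : derivative_seq c a -> a 0%N 0 = 0 ->
  jointly_lipschitz n
    (fun u hs x => a n (u x) * \prod_(i < n) nth (0 : E) hs i x).
Proof.
move=> da a00; case: n => [|n].
  rewrite (_ : (fun u hs => _) = (fun u hs x => a 0%N (u x) - a 0%N 0)).
    exact: jointly_lipschitz_superposition.
  by apply/funext => u; apply/funext => hs; apply/funext => x;
    rewrite big_ord0 mulr1 a00 subr0.
rewrite (_ : (fun u hs => _) = (fun u hs x =>
  (a n.+1 (u x) - a n.+1 0) * (\prod_(i < n.+1) nth (0 : E) hs i x) +
  a n.+1 0 * (\prod_(i < n.+1) nth (0 : E) hs i x))).
  apply: jointly_lipschitzD; last exact/jointly_lipschitzZ/jointly_lipschitz_prod.
  apply: jointly_lipschitzM; last exact: jointly_lipschitz_prod.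
  exact: jointly_lipschitz_superposition.
by apply/funext => u; apply/funext => hs; apply/funext => x; ring.
Qed.

End JointlyLipschitz.

Section FrechetSmooth.
Context {R : realType}.
Local Notation E := (R -> R^o).
Implicit Types (f g h u v w : R -> R) (x y c e t : R) (hs ks : seq E)
  (a : nat -> R -> R).

Lemma Winf1P f : Winf1 f <-> smoothL1 f.
Proof. by split; [exact: Winf1_smoothL1|exact: smoothL1_Winf1]. Qed.

Lemma sobolev_norm_cvg0 (q : R -> R -> R) m (K d : R) : 0 < d -> 0 <= K ->
  (forall t, t != 0 -> `|t| <= d -> smoothL1 (q t) /\ wnorm m (q t) <= K * `|t|) ->
  sobolev_norm m (q t) @[t --> (0 : R)^'] --> (0 : R).
Proof.
move=> d0 K0 hq; apply/cvgrPdist_le => /= e e0.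
have r0 : 0 < Num.min d (e / (K + 1)) by rewrite lt_min d0 divr_gt0// ltr_wpDl.
have K1 : 0 < K + 1 by rewrite ltr_wpDl.
near=> t.
have t0 : t != 0 by near: t; exact: nbhs_dnbhs_neq.
have : `|t| <= Num.min d (e / (K + 1)).
  by near: t; apply: nbhs_dnbhs; exact: (@nbhs0_le _ R _ r0).
rewrite le_min => /andP[td te].
have [sq hqt] := hq t t0 td.
rewrite sub0r normrN sobolev_wnorm// ger0_norm ?wnorm_ge0//.
apply: (le_trans hqt); apply: (@le_trans _ _ ((K + 1) * `|t|)).
  by rewrite ler_wpM2r// lerDl.
by rewrite -ler_pdivlMl// mulrC.
Unshelve. all: by end_near. Qed.

Lemma directionsP n hs : size hs = n ->
  (forall i, (i < n)%N -> Winf1 (nth (0 : E) hs i)) -> directions n hs.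
Proof. by move=> sh dh; split => // i ni; apply/Winf1P; exact: dh. Qed.

Lemma superposition_frechet_open c : 0 < c ->
  frechet_open (@Winf1_frechet R) [set u : E | above c u].
Proof.
move=> c0; split; first by move=> u [su _]; exact/Winf1P.
move=> u [su cu]; have [lo [hi [d [clo lo0 hi0 d0 ru]]]] := smoothL1_bounds c0 su cu.
exists 1%N, d => // h /Winf1P sh /=; rewrite sobolev_wnorm// => hd.
split; first exact: smoothL1D.
move=> x; have := wnorm_sup 0 x sh; have := ru x; rewrite ler_norml.
by move=> /andP[h1 _] /andP[h2 _]; rewrite /GRing.add/=; lra.
Qed.

(** For fixed [hs] the map is [u |-> a n \o u] times a fixed product [P], so the error of its
    difference quotient is [q t * P], and [superposition_quotient] for the shifted sequence makes
    [q t] of size O(t). *)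
Lemma superposition_derive_is_derive c a hs u h : 0 < c -> derivative_seq c a ->
  a 0%N 0 = 0 -> above c u -> smoothL1 h -> directions (size hs) hs ->
  is_dirderive (@Winf1_frechet R) ((superposition_derive a)^~ hs : E -> E) u h
    (superposition_derive a u (h :: hs)).
Proof.
move=> c0 da a00 [su cu] sh dh m.
have [lo [hi [d [clo lo0 hi0 d0 ru]]]] := smoothL1_bounds c0 su cu.
have ru' : ranges_in lo hi u by move=> x; have := ru x; lra.
have W0 := wnorm_ge0 1 h.
have W1 : 0 < 1 + wnorm 1 h by rewrite ltr_pwDl.
(* The second bound keeps [u + t h] within the margin [d] of the range of [u], as [wnorm 1 h]
   dominates the supremum of [h]; the bound [1] is the one under which the quotient estimate
   holds. *)
pose d' := Num.min 1 (d / (1 + wnorm 1 h)).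
have d'0 : 0 < d' by rewrite lt_min ltr01 divr_gt0.
have rt t : `|t| <= d' -> ranges_in lo hi (fun x => u x + t * h x).
  rewrite le_min => /andP[_]; rewrite ler_pdivlMr// => td x.
  have : `|t * h x| <= d.
    rewrite normrM; apply: le_trans td; rewrite ler_wpM2l//.
    by have := wnorm_sup 0 x sh; lra.
  by rewrite ler_norml; have := ru x; lra.
pose n := size hs; pose P x : R := \prod_(i < n) nth (0 : E) hs i x.
pose q t x := t^-1 * (a n (u x + t * h x) - a n (u x)) - a n.+1 (u x) * h x.
have sq t : `|t| <= d' -> smoothL1 (q t).
  move=> td; have sth : smoothL1 (fun x => u x + t * h x).
    by apply: smoothL1D => //; exact: smoothL1Z.
  apply: smoothL1B; last exact: (smoothL1_superpositionM clo lo0 hi0).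
  by apply: smoothL1Z; exact: (smoothL1_superpositionB clo lo0 hi0 n da su ru' sth (rt t td)).
have hq k : exists2 K, 0 <= K & forall t, t != 0 -> `|t| <= d' -> wnorm k (q t) <= K * `|t|.
  have [K K0 hK] := superposition_quotient clo lo0 hi0 k su ru' sh
    (derivative_seq_shift n da).
  exists K => // t t0 td; have := hK t t0 _ (rt t td).
  rewrite addn0 addn1; apply.
  by move: td; rewrite le_min => /andP[].
rewrite (_ : (fun t => _) = (fun t => sobolev_norm m (fun x => q t x * P x))); last first.
  apply/funext => t; congr sobolev_norm; apply/funext => x.
  transitivity (t^-1 * (a n (u x + t * h x) * P x - a n (u x) * P x) -
    a n.+1 (u x) * \prod_(i < n.+1) nth (0 : E) ((h : E) :: hs) i x) => //.
  by rewrite big_ord_recl/= -/(P x) /q; ring.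
have [K K0 hK] := hq m.+1; have [K' K'0 hK'] := hq m.
have [C C0 hC] := @wnormM R m.
(* Without directions [P] is the constant [1], which is not integrable, so the product estimate is
   reserved for [n > 0]. *)
have [n0|n0] := posnP n.
  apply: (sobolev_norm_cvg0 d'0 K'0) => t t0 td.
  rewrite (_ : (fun x => _) = q t); first by split; [exact: sq|exact: hK'].
  by apply/funext => x; rewrite /P n0 big_ord0 mulr1.
have sP : smoothL1 P.
  have n1 : (n.-1 < n)%N by rewrite prednK.
  have [+ _] := jointly_lipschitz_prod n1 (conj su cu) dh.
  by congr smoothL1; apply/funext => x; rewrite /P prednK.
have CK : 0 <= C * K * wnorm m P by rewrite !mulr_ge0 ?wnorm_ge0.
apply: (sobolev_norm_cvg0 d'0 CK) => t t0 td; split.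
  by apply: smoothL1M => //; exact: sq.
apply: (le_trans (hC _ _ (sq t td) sP)).
by rewrite [leRHS]mulrAC ler_wpM2r ?wnorm_ge0// -mulrA ler_wpM2l// hK.
Qed.

Theorem superposition_smooth c a : 0 < c -> derivative_seq c a -> a 0%N 0 = 0 ->
  frechet_smooth (@Winf1_frechet R) (@Winf1_frechet R) [set u : E | above c u]
    (fun u x => a 0%N (u x)).
Proof.
move=> c0 da a00; split; first exact: superposition_frechet_open.
exists (superposition_derive a); split.
- move=> u _; rewrite /superposition_derive/=; apply/funext => x.
  by rewrite big_ord0 mulr1.
- move=> u hs au dh; apply/Winf1P.
  by have [] := jointly_lipschitz_superposition_derive c0 da a00 au (directionsP erefl dh).
- move=> u h hs au /Winf1P sh dh.
  exact: (superposition_derive_is_derive c0 da a00 au sh (directionsP erefl dh)).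
- move=> u hs au dh m e e0.
  have dhs := directionsP erefl dh.
  have [sD /(_ m)[N [d [K [d0 K0 hK]]]]] :=
    jointly_lipschitz_superposition_derive c0 da a00 au dhs.
  have K1 : 0 < K + 1 by rewrite ltr_wpDl.
  (* This minimum serves both as the radius and as [rho]; the denominator [K + 1] allows for [K = 0]
     and makes the final inequality strict. *)
  have r0 : 0 < Num.min d (e / (K + 1)) by rewrite lt_min d0 divr_gt0.
  exists N, (Num.min d (e / (K + 1))) => // v ks av sk dk vu kh.
  have dks := directionsP sk dk.
  have [sDv _] := jointly_lipschitz_superposition_derive c0 da a00 av dks.
  have rd : Num.min d (e / (K + 1)) <= d by rewrite ge_min lexx.
  have re : Num.min d (e / (K + 1)) <= e / (K + 1) by rewrite ge_min lexx orbT.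
  have sDB := smoothL1B sDv sD.
  rewrite /= (_ : _ - _ = (fun x =>
    a (size hs) (v x) * \prod_(i < size hs) nth (0 : E) ks i x -
    a (size hs) (u x) * \prod_(i < size hs) nth (0 : E) hs i x)); last first.
    by apply/funext => x; rewrite /superposition_derive/= -sk.
  rewrite sobolev_wnorm//; apply: le_lt_trans (hK v ks _ av dks (ltW r0) rd _ _) _.
  + by rewrite -sobolev_wnorm; [exact: ltW|case: av => sv _; case: au => su _; exact: smoothL1B].
  + move=> i ni; rewrite -sobolev_wnorm; first exact: (ltW (kh i ni)).
    by apply: smoothL1B; [case: dks => _; apply|case: dhs => _; apply].
  + apply: (@le_lt_trans _ _ (K * (e / (K + 1)))); first by rewrite ler_wpM2l.
    by rewrite mulrA ltr_pdivrMr// mulrC ltr_pM2l// ltrDl.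
Qed.

End FrechetSmooth.

(** * Transport along the isometry u |-> derive1 u *)

Section Transport.
Context {R : realType}.
Local Notation E := (R -> R^o).
Implicit Types (f g h u v w : R -> R) (x y c e t : R) (hs ks : seq E) (A : set E).
Local Notation mu := (@lebesgue_measure R).

Lemma g_minf_smoothL1 u : g_minf u -> smoothL1 u^`().
Proof. by case=> _ /Winf1P. Qed.

Lemma g_minf_is_derive u x : g_minf u -> is_derive x (1 : R) u (u^`() x).
Proof. by case=> du _ _; exact: derivable_is_derive1. Qed.

Lemma derive1_primitive w : smoothL1 w -> (primitive w)^`() = w.
Proof.
move=> sw; apply: derive1_is_derive => x; apply: is_derive_primitive.
  exact: smoothL1_integrable.
exact: smoothL1_continuous.
Qed.

Lemma primitive_g_minf w : smoothL1 w -> g_minf (primitive w).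
Proof.
move=> sw; split.
- move=> x; have [] // := is_derive_primitive x (smoothL1_integrable sw) (smoothL1_continuous sw).
- by rewrite derive1_primitive//; exact/Winf1P.
- by apply: primitive_cvg0; exact: smoothL1_integrable.
Qed.

(** The difference has derivative [0], hence is constant, and the limits at -oo force the constant
    to be [0]. *)
Lemma primitive_derive1 u : g_minf u -> primitive u^`() = u.
Proof.
move=> gu; have su' := g_minf_smoothL1 gu.
have d x : is_derive x (1 : R) (fun y => u y - primitive (derive1 u) y) 0.
  apply: is_derive1_eq (is_derive1B (g_minf_is_derive x gu) (is_derive_primitive x
    (smoothL1_integrable su') (smoothL1_continuous su'))) => //.
  by rewrite subrr.
apply/funext => x; apply/esym/eqP; rewrite -subr_eq0; apply/eqP.
have h : (u y - primitive (derive1 u) y) @[y --> -oo] --> (0 - 0 : R).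
  apply: cvgB; first by case: gu.
  by apply: primitive_cvg0; exact: smoothL1_integrable.
move: h; rewrite subr0 (_ : (fun y => _) = cst (u x - primitive (derive1 u) x)).
  move=> /cvg_unique h; apply/esym/h; [exact: Rhausdorff|exact: cvg_cst].
by apply/funext => y; exact: (is_derive_0_is_cst y x d).
Qed.

Lemma derive1_addZ u h t : g_minf u -> g_minf h ->
  derive1 (fun x => u x + t * h x) = (fun x => derive1 u x + t * derive1 h x).
Proof.
move=> gu gh; apply: derive1_is_derive => x.
apply: is_derive1D; first exact: g_minf_is_derive.
by apply: is_derive1Z; exact: g_minf_is_derive.
Qed.

Lemma g_minf_addZ u h t : g_minf u -> g_minf h -> g_minf (fun x => u x + t * h x).
Proof.
move=> gu gh; split.
- move=> x; have [] // := is_derive1D (g_minf_is_derive x gu)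
    (is_derive1Z t (g_minf_is_derive x gh)).
- rewrite derive1_addZ//; apply/Winf1P; apply: smoothL1D; first exact: g_minf_smoothL1.
  by apply: smoothL1Z; exact: g_minf_smoothL1.
- rewrite (_ : (0 : R) = 0 + t * 0); last by rewrite mulr0 addr0.
  apply: cvgD; first by case: gu.
  by apply: cvgM; [exact: cvg_cst|case: gh].
Qed.

Lemma eq_frechet_smooth (V W : frechetData E) A (F G : E -> E) :
  (forall u : E, A u -> F u = G u) -> frechet_smooth V W A F -> frechet_smooth V W A G.
Proof.
move=> FG [oA [D [D0 DW dD cD]]]; split => //; exists D; split => // x Ax.
by rewrite D0// FG.
Qed.

Lemma nth_map_derive1 hs i : (i < size hs)%N ->
  nth (0 : E) (map (fun h : E => (derive1 (h : R -> R) : E)) hs) i =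
  derive1 (nth (0 : E) hs i : R -> R).
Proof. by move=> ih; rewrite (nth_map (0 : E)). Qed.

(* Differentiation is a linear isometry of the space of the [u] with [u'] in
   [Winf1] and [u(-oo) = 0] onto [Winf1], with inverse [primitive]. *)
Lemma frechet_smooth_derive1 A (F : E -> E) :
  frechet_smooth (@Winf1_frechet R) (@Winf1_frechet R) A F ->
  frechet_smooth (@g_minf_frechet R) (@Winf1_frechet R)
    [set u : E | g_minf u /\ A (derive1 (u : R -> R))] (fun u => F (derive1 (u : R -> R))).
Proof.
move=> [[AW oA] [D [D0 DW dD cD]]].
pose map' := map (fun h : E => (derive1 (h : R -> R) : E)).
have vm hs : (forall i, (i < size hs)%N -> g_minf (nth (0 : E) hs i)) ->
    forall i, (i < size (map' hs))%N -> Winf1 (nth (0 : E) (map' hs) i).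
  move=> gh i; rewrite size_map => ih; rewrite nth_map_derive1//.
  by have [] := gh i ih.
split; first split; first by move=> u [].
  move=> u [gu Au]; have [n [e e0 he]] := oA _ Au.
  exists n; exists e; first exact: e0.
  move=> h gh hn; have := g_minf_addZ 1 gu gh; have := derive1_addZ 1 gu gh.
  rewrite (_ : (fun x => u x + 1 * h x) = u + h); last first.
    by apply/funext => x; rewrite mul1r.
  move=> duh guh; split => //; rewrite duh.
  have := he (derive1 (h : R -> R)) _ hn; rewrite (_ : (fun x => _) =
    (derive1 (u : R -> R) : E) + (derive1 (h : R -> R) : E)).
    by apply; have [] := gh.
  by apply/funext => x; rewrite mul1r.
exists (fun u hs => D (derive1 (u : R -> R)) (map' hs)); split.
- by move=> u [_ Au]; exact: D0.
- by move=> u hs [_ Au] gh; apply: DW => //; exact: vm.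
- move=> u h hs [gu Au] gh ghs m.
  have duh t : (derive1 (u + t *: h : R -> R) : E) =
      (derive1 (u : R -> R) : E) + t *: (derive1 (h : R -> R) : E).
    exact: (derive1_addZ t gu gh).
  have Wh' : Winf1 (derive1 (h : R -> R)) by have [] := gh.
  apply: cvg_trans (dD _ _ (map' hs) Au Wh' (vm _ ghs) m); apply: near_eq_cvg.
  by near=> t; rewrite duh.
- move=> u hs [gu Au] gh m e e0.
  have [n [d d0 hd]] := cD _ (map' hs) Au (vm _ gh) m e e0.
  have dS (p q : E) : g_minf p -> g_minf q ->
      snorm (@Winf1_frechet R) n ((derive1 (p : R -> R) : E) - (derive1 (q : R -> R) : E)) =
      snorm (@g_minf_frechet R) n (p - q).
    move=> gp gq; rewrite /=; congr sobolev_norm; apply/esym.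
    by apply: derive1_is_derive => x; apply: is_derive1B; exact: g_minf_is_derive.
  exists n; exists d; first exact: d0.
  move=> v ks [gv Av] sk gk vu kh; apply: hd.
  + exact: Av.
  + by rewrite !size_map.
  + by move=> i; rewrite size_map -sk => ik; apply: (vm ks); rewrite ?size_map// => j; rewrite sk; exact: gk.
  + by rewrite (dS _ _ gv gu).
  + move=> i; rewrite size_map => ih.
    have ik : (i < size ks)%N by rewrite sk.
    rewrite /map' (nth_map_derive1 ik) (nth_map_derive1 ih).
    by rewrite (dS _ _ (gk i ih) (gh i ih)); exact: (kh i ih).
Unshelve. all: by end_near. Qed.

Lemma snorm_primitiveB m v w : smoothL1 v -> smoothL1 w ->
  snorm (@g_minf_frechet R) m ((primitive v : E) - (primitive w : E)) =
  sobolev_norm m ((v : E) - (w : E)).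
Proof.
move=> sv sw; rewrite /=; congr sobolev_norm.
apply: derive1_is_derive => x.
by apply: is_derive1B; apply: is_derive_primitive;
  [exact: smoothL1_integrable|exact: smoothL1_continuous|
   exact: smoothL1_integrable|exact: smoothL1_continuous].
Qed.

(** Composition on the left with a linear isometry: the derivatives of all orders are the primitives
    of those of [F], with the same seminorms. *)
Lemma frechet_smooth_primitive A (F : E -> E) :
  frechet_smooth (@Winf1_frechet R) (@Winf1_frechet R) A F ->
  frechet_smooth (@Winf1_frechet R) (@g_minf_frechet R) A (fun u => (primitive (F u) : E)).
Proof.
move=> [[AW oA] [D [D0 DW dD cD]]]; split => //.
have sD u hs : A u -> (forall i, (i < size hs)%N -> vect (@Winf1_frechet R) (nth (0 : E) hs i)) ->
    smoothL1 (D u hs).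
  by move=> Au vh; apply/Winf1P; exact: DW.
exists (fun u hs => (primitive (D u hs) : E)); split.
- by move=> u Au; rewrite D0.
- by move=> u hs Au vh; apply: primitive_g_minf; exact: sD.
- move=> u h hs Au Wh vh m.
  have sh : smoothL1 h by exact/Winf1P.
  have [n [e e0 he]] := oA _ Au.
  have W1 : 0 < wnorm n h + 1 by rewrite ltr_wpDl ?wnorm_ge0.
  apply: cvg_trans (dD u h hs Au Wh vh m); apply: near_eq_cvg.
  near=> t.
  (* Only on [A] is the value of [D] known to be integrable and smooth, which is what
     differentiating its primitive takes; openness of [A] provides this for small [t]. *)
  have Aut : A (u + t *: h).
    have sth : smoothL1 (t *: (h : E)) by exact: (smoothL1Z t sh).
    apply: he; first exact/Winf1P.
    rewrite /= sobolev_wnorm// (wnormZ n t sh).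
    apply: (@le_lt_trans _ _ (e / (wnorm n h + 1) * wnorm n h)).
      rewrite ler_wpM2r ?wnorm_ge0//; near: t; apply: nbhs_dnbhs.
      by apply: (@nbhs0_le _ R); rewrite divr_gt0.
    by rewrite mulrAC ltr_pdivrMr// ltr_pM2l// ltrDl.
  rewrite /=; congr sobolev_norm; apply/esym.
  have dp w x : smoothL1 w -> is_derive x (1 : R) (primitive w) (w x).
    by move=> sw; apply: is_derive_primitive; [exact: smoothL1_integrable|exact: smoothL1_continuous].
  apply: derive1_is_derive => x.
  apply: (is_derive1B (is_derive1Z t^-1 (is_derive1B (dp _ x _) (dp _ x _))) (dp _ x _)).
  + exact: sD.
  + exact: sD.
  + by apply: sD => // -[|i] //=; exact: vh.
- move=> u hs Au vh m e e0; have [n [d d0 hd]] := cD u hs Au vh m e e0.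
  exists n; exists d; first exact: d0.
  move=> v ks Av sk vk vu kh.
  by rewrite snorm_primitiveB; [exact: hd|apply: sD => //; rewrite sk|exact: sD].
Unshelve. all: by end_near. Qed.

End Transport.

(** * Power functions and diffeomorphisms *)

Section PowerSequence.
Context {R : realType}.
Implicit Types (x y s r : R).

(* The successive derivatives of [b ((k s + 1)^p - 1)]. *)
Definition power_seq (b k p : R) (n : nat) (s : R) : R :=
  b * k ^+ n * ((\prod_(i < n) (p - i%:R)) * (k * s + 1) `^ (p - n%:R) - (n == 0)%:R).

Lemma power_seqP b k p : 0 < k -> derivative_seq k^-1 (power_seq b k p).
Proof.
move=> k0 n s ks.
have pos : 0 < k * s + 1.
  move: ks; rewrite -(ltr_pM2l k0) mulrN divff ?gt_eqF// => ?; lra.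
have d1 := @is_derive1_comp _ (fun y : R => y `^ (p - n%:R)) (fun y => k * y + 1) s _ _
  (is_derive1_powR (p - n%:R) pos) (is_derive1_affine k 1 s).
have d2 := is_derive1B (is_derive1Z (\prod_(i < n) (p - i%:R)) d1)
  (is_derive1_cst ((n == 0)%:R) s).
apply: is_derive1_eq (is_derive1Z (b * k ^+ n) d2) => //.
rewrite /power_seq big_ord_recr/= exprS subr0 subr0.
rewrite -[n.+1%:R]natr1 opprD addrA; ring.
Qed.

Lemma power_seq0 b k p s : power_seq b k p 0 s = b * ((k * s + 1) `^ p - 1).
Proof. by rewrite /power_seq big_ord0 expr0 mulr1 mul1r subr0. Qed.

Lemma power_seq00 b k p : power_seq b k p 0 0 = 0.
Proof. by rewrite power_seq0 mulr0 add0r powR1 subrr mulr0. Qed.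

Variables (r : R) (r1 : 1 <= r).
Let r0 : 0 < r. Proof. exact: lt_le_trans r1. Qed.

Definition root_seq := power_seq r 1 r^-1.
Definition pow_seq := power_seq 1 r^-1 r.

Lemma root_seqP : derivative_seq 1 root_seq.
Proof. by have := power_seqP r r^-1 ltr01; rewrite invr1. Qed.

Lemma pow_seqP : derivative_seq r pow_seq.
Proof. by have := @power_seqP 1 r^-1 r; rewrite invr_gt0 invrK; apply. Qed.

Lemma root_seq0 s : root_seq 0 s = r * ((1 + s) `^ r^-1 - 1).
Proof. by rewrite /root_seq power_seq0 mul1r [s + 1]addrC. Qed.

Lemma pow_seq0 s : pow_seq 0 s = (s / r + 1) `^ r - 1.
Proof. by rewrite /pow_seq power_seq0 mul1r mulrC. Qed.

Lemma root_seq1 s : root_seq 1 s = (1 + s) `^ (r^-1 - 1).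
Proof.
rewrite /root_seq /power_seq big_ord_recr big_ord0/= expr1 mulr1 mul1r subr0 subr0.
by rewrite mulrA divff ?gt_eqF// !mul1r addrC.
Qed.

Lemma root_seqK s : - 1 < s -> pow_seq 0 (root_seq 0 s) = s.
Proof.
move=> s1; rewrite pow_seq0 root_seq0 mulrAC divff ?gt_eqF// mul1r subrK.
by rewrite -powRrM mulVf ?gt_eqF// powRr1 ?(addrC 1) ?addrK//; lra.
Qed.

Lemma pow_seqK s : - r < s -> root_seq 0 (pow_seq 0 s) = s.
Proof.
move=> sr; rewrite root_seq0 pow_seq0 [1 + _]addrC subrK -powRrM divff ?gt_eqF//.
have s1 : - 1 < s / r by rewrite ltr_pdivlMr// mulN1r.
by rewrite powRr1 ?addrK; [rewrite mulrC divfK// gt_eqF|lra].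
Qed.

Lemma root_seq_gt s : - 1 < s -> - r < root_seq 0 s.
Proof.
move=> s1; have : 0 < (1 + s) `^ r^-1 by rewrite powR_gt0//; lra.
by move=> ?; rewrite root_seq0 -subr_gt0 opprK -[X in _ + X]mulr1 -mulrDr subrK mulr_gt0.
Qed.

Lemma pow_seq_gt s : - r < s -> - 1 < pow_seq 0 s.
Proof.
move=> sr; have s1 : - 1 < s / r by rewrite ltr_pdivlMr// mulN1r.
have : 0 < (s / r + 1) `^ r by rewrite powR_gt0//; lra.
by rewrite pow_seq0 => ?; lra.
Qed.

(** The change of variables asks for a continuous integrand. The power is differentiable away from
    [0]; at a zero of [g] the threshold e^(1/r) on [|g|] gives [e] on the power. *)
Lemma continuous_norm_powR (g : R -> R) : continuous g ->
  continuous (fun x => `|g x| `^ r).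
Proof.
move=> cg x; have [gx0|gx0] := eqVneq (g x) 0.
  apply/cvgrPdist_le => /= e e0.
  have er0 : 0 < e `^ r^-1 by rewrite powR_gt0.
  rewrite gx0 normr0 powR0 ?gt_eqF//; near=> y.
  rewrite sub0r normrN ger0_norm ?powR_ge0//.
  rewrite -[leRHS]powRr1 ?(ltW e0)// -(@mulVf _ r) ?gt_eqF// powRrM.
  rewrite ge0_ler_powR ?nnegrE ?powR_ge0// ?(ltW r0)//.
  near: y; move/cvgrPdist_le : (cg x) => /(_ _ er0).
  by apply: filterS => y; rewrite gx0 sub0r normrN.
have gx : 0 < `|g x| by rewrite normr_gt0.
have cp : {for `|g x|, continuous (fun z : R => z `^ r)}.
  apply: differentiable_continuous; apply/derivable1_diffP.
  by have [] := is_derive1_powR r gx.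
apply: (@cvg_comp _ _ _ (fun y => `|g y|) (fun z : R => z `^ r) _ (nbhs `|g x|)).
  by apply: (@cvg_norm _ R) => /=; exact: cg.
exact: cp.
Unshelve. all: by end_near. Qed.

End PowerSequence.

Section Diffeomorphism.
Context {R : realType}.
Local Notation E := (R -> R^o).
Implicit Types (g h u v w X : R -> R) (x y e t : R).
Local Notation mu := (@lebesgue_measure R).

Variables (f : R -> R) (cf : diff_chart f).
Let phi x := x + f x.

Let gf : g_minf f. Proof. by case: cf. Qed.
Let f1 x : -1 < derive1 f x. Proof. by case: cf. Qed.
Let sf : smoothL1 f^`(). Proof. exact: g_minf_smoothL1. Qed.

Lemma diff_is_derive x : is_derive x (1 : R) phi (1 + derive1 f x).
Proof. by apply: is_derive1D; exact: g_minf_is_derive. Qed.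

Lemma diff_derive1 : phi^`() = (fun x => 1 + derive1 f x).
Proof. by apply: derive1_is_derive => x; exact: diff_is_derive. Qed.

Lemma diff_continuous : continuous phi.
Proof. by apply: derivable_continuousT => x; case: (diff_is_derive x). Qed.

(** The gap lemma with [c = 1]: the pointwise bound [f' > -1] becomes uniform because [f'] decays at
    infinity. *)
Lemma diff_derive1_ge : exists2 d, 0 < d & forall x, d <= 1 + derive1 f x.
Proof.
have [lo [hi [d [lo1 _ _ d0 h]]]] := smoothL1_bounds ltr01 sf f1.
by exists (1 + lo + d) => [|x]; [lra|have /andP[? _] := h x; lra].
Qed.

Lemma diff_expansive : exists2 d, 0 < d & forall x y, x <= y -> d * (y - x) <= phi y - phi x.
Proof.
have [d d0 hd] := diff_derive1_ge; exists d => // x y xy.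
have cphi : {within `[x, y], continuous phi}.
  by apply: continuous_subspaceT; exact: diff_continuous.
have [z _ ->] := MVT_segment xy (fun z _ => diff_is_derive z) cphi.
by rewrite ler_wpM2r// subr_ge0.
Qed.

Lemma diff_increasing : {homo phi : x y / x < y}.
Proof.
move=> x y xy; have [d d0 hd] := diff_expansive.
by rewrite -subr_gt0; apply: lt_le_trans (hd x y (ltW xy)); rewrite mulr_gt0// subr_gt0.
Qed.

Lemma diff_cvgNy : phi x @[x --> -oo] --> -oo.
Proof.
have [d d0 hd] := diff_expansive; apply/cvgrNyPle => M; near=> x.
have x0 : x <= 0 by near: x; apply: nbhs_ninfty_le; exact: num_real.
have := hd x 0 x0; rewrite sub0r => h.
have : x <= (M - phi 0) / d by near: x; apply: nbhs_ninfty_le; exact: num_real.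
by rewrite ler_pdivlMr// => h'; lra.
Unshelve. all: by end_near. Qed.

Lemma diff_cvgy : phi x @[x --> +oo] --> +oo.
Proof.
have [d d0 hd] := diff_expansive; apply/cvgryPge => M; near=> x.
have x0 : 0 <= x by near: x; apply: nbhs_pinfty_ge; exact: num_real.
have := hd 0 x x0; rewrite subr0 => h.
have : (M - phi 0) / d <= x by near: x; apply: nbhs_pinfty_ge; exact: num_real.
by rewrite ler_pdivrMr// => h'; lra.
Unshelve. all: by end_near. Qed.

Lemma diff_surjective y : exists x, phi x = y.
Proof.
(* By expansiveness, [phi] at [M] and at [- M] lies above and below [phi 0] by at least
   [|y - phi 0|], so these values enclose [y]. *)
have [d d0 hd] := diff_expansive; pose M := `|y - phi 0| / d.
have M0 : 0 <= M by rewrite divr_ge0// ltW.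
have MM : - M <= M by lra.
have dM : d * M = `|y - phi 0| by rewrite mulrC divfK ?gt_eqF.
have h1 := hd 0 M M0; have h2 := hd (- M) 0; move: h2; rewrite oppr_le0 => /(_ M0).
rewrite sub0r opprK => h2; move: h1; rewrite subr0 => h1.
have h3 := ler_norm (y - phi 0); have h4 := ler_norm (- (y - phi 0)).
rewrite normrN in h4.
have [||x _ <-] := @IVT R phi (- M) M y MM; last by exists x.
  by apply: continuous_subspaceT; exact: diff_continuous.
by rewrite ge_min le_max; apply/andP; split; apply/orP; [left|right]; lra.
Qed.

Lemma diff_pinvK y : phi (pinv setT phi y) = y.
Proof.
apply: (@surjpK _ _ _ setT setT phi); last by rewrite inE.
by move=> z _; have [x <-] := diff_surjective z; exists x.
Qed.

Lemma derive1_diff_cvgy : cvg (phi^`() x @[x --> +oo]).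
Proof.
apply/cvg_ex; exists 1; rewrite diff_derive1; apply/cvgrPdist_le => /= e e0.
have [N N0 hN] := smoothL1_decay sf e0; near=> x.
rewrite opprD addrA subrr sub0r normrN; apply: hN; apply: (le_trans _ (ler_norm x)).
by near: x; apply: nbhs_pinfty_ge; exact: num_real.
Unshelve. all: by end_near. Qed.

Lemma derive1_diff_cvgNy : cvg (phi^`() x @[x --> -oo]).
Proof.
apply/cvg_ex; exists 1; rewrite diff_derive1; apply/cvgrPdist_le => /= e e0.
have [N N0 hN] := smoothL1_decay sf e0; near=> x.
rewrite opprD addrA subrr sub0r normrN; apply: hN; rewrite -normrN.
apply: (le_trans _ (ler_norm (- x))); rewrite lerNr.
by near: x; apply: nbhs_ninfty_le; exact: num_real.
Unshelve. all: by end_near. Qed.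

Lemma diff_change_of_variables g : continuous g -> (forall x, 0 <= g x) ->
  (\int[mu]_x (g x)%:E = \int[mu]_x (g (phi x) * (1 + derive1 f x))%:E)%E.
Proof.
move=> cg g0.
have cd : continuous phi^`().
  rewrite diff_derive1 => x; apply: cvgD; first exact: cvg_cst.
  exact: smoothL1_continuous.
rewrite (increasing_ge0_integration_by_substitutionT diff_increasing cd
  derive1_diff_cvgNy derive1_diff_cvgy _ diff_cvgNy diff_cvgy cg g0); last first.
  by move=> x; case: (diff_is_derive x).
by rewrite diff_derive1.
Qed.

(** The Jacobian is at least some [d > 0], so [|w \o phi|] is at most [d^-1] times the integrand
    that the change of variables produces from [|w|]. *)
Lemma integrable_fun_diff w : smoothL1 w -> integrable_fun (w \o phi).
Proof.
move=> sw; have cw := smoothL1_continuous sw.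
have cwphi : continuous (w \o phi).
  by move=> x; apply: continuous_comp; [exact: diff_continuous|exact: cw].
have [d d0 hd] := diff_derive1_ge.
have mwphi := continuous_measurableT cwphi.
have mg : measurable_fun setT (fun x => w (phi x) * (1 + derive1 f x)).
  apply: measurable_funM => //; apply: measurable_funD => //.
  exact: smoothL1_measurable.
apply: (@le_integrable_fun _ d^-1 _ (fun x => w (phi x) * (1 + derive1 f x))) => //.
  move=> x; rewrite normrM mulrC -mulrA ler_peMr// ger0_norm.
    by rewrite ler_pdivlMr// mul1r.
  exact: le_trans (ltW d0) (hd x).
apply/integrableP; split; first exact/measurable_EFinP.
have /integrableP[_] := smoothL1_integrable sw.
rewrite (_ : (\int[mu]_x `|(EFin \o w) x|)%E = (\int[mu]_x (`|w x|)%:E)%E)//.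
rewrite (diff_change_of_variables (g := fun x => `|w x|)) => //; last first.
  by move=> x; apply: (@cvg_norm _ R); exact: cw.
congr (_ < _)%E; apply: eq_integral => x _ /=.
rewrite normrM [`|1 + _|]ger0_norm//; exact: le_trans (ltW d0) (hd x).
Qed.

(** The factor [1 + f'] of the chain rule is not integrable, so the derivative is written as
    [w' \o phi + f' (w' \o phi)], and the induction on the order is applied to [w']. *)
Lemma smoothL1_diff w : smoothL1 w -> smoothL1 (w \o phi).
Proof.
move=> sw; apply/smoothL1P => k; elim: k w sw => [|k IH] w sw.
all: have d x : is_derive x (1 : R) (w \o phi) (derive1 w (phi x) * (1 + derive1 f x)) by
  exact: is_derive1_comp (smoothL1_is_derive _ sw) (diff_is_derive x).
all: have cwphi : continuous (w \o phi) by
  apply: derivable_continuousT => x; case: (d x).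
all: split => //; try exact: integrable_fun_diff.
split; first by move=> x; case: (d x).
rewrite (derive1_is_derive d) (_ : (fun x => _) =
  (fun x => derive1 w (phi x) + derive1 f x * derive1 w (phi x))); last first.
  by apply/funext => x; ring.
have IHw := IH _ (smoothL1_derive1 sw).
by apply: L1regD => //; apply: L1regM => //; exact: (smoothL1P _).1.
Qed.

Lemma g_minf_diff X : g_minf X -> g_minf (X \o phi) /\
  derive1 (X \o phi) = (fun x => derive1 X (phi x) * (1 + derive1 f x)).
Proof.
move=> gX.
have d x : is_derive x (1 : R) (X \o phi) (derive1 X (phi x) * (1 + derive1 f x)).
  exact: is_derive1_comp (g_minf_is_derive _ gX) (diff_is_derive x).
have dX := derive1_is_derive d; split => //; split.
- by move=> x; case: (d x).
- rewrite dX; apply/Winf1P.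
  rewrite (_ : (fun x => _) =
    (fun x => derive1 X (phi x) + derive1 f x * derive1 X (phi x))); last first.
    by apply/funext => x; ring.
  have sX := smoothL1_diff (g_minf_smoothL1 gX).
  by apply: smoothL1D => //; exact: smoothL1M.
- by apply: (cvg_comp _ _ diff_cvgNy); case: gX.
Qed.

End Diffeomorphism.

(** * The map Phi *)

Section Chart.
Context {R : realType}.
Local Notation E := (R -> R^o).
Implicit Types (f g h u v w phi : R -> R) (x y e t : R).
Local Notation mu := (@lebesgue_measure R).

Variables (r : R) (r1 : 1 <= r).
Let r0 : 0 < r. Proof. exact: lt_le_trans r1. Qed.

Lemma above_superposition c (a : nat -> R -> R) u : 0 < c -> derivative_seq c a ->
  a 0%N 0 = 0 -> above c u -> smoothL1 (fun x => a 0%N (u x)).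
Proof.
move=> c0 da a00 [su cu].
have [lo [hi [d [clo lo0 hi0 d0 ru]]]] := smoothL1_bounds c0 su cu.
have ru' : ranges_in lo hi u by move=> x; have := ru x; lra.
have := smoothL1_superposition0 clo lo0 hi0 da su ru'.
by under eq_fun do rewrite a00 subr0.
Qed.

Lemma chart_above f : diff_chart f -> above 1 f^`().
Proof. by move=> [gf f1]; split => //; exact: g_minf_smoothL1. Qed.

Lemma diff_chartE : (@diff_chart R : set E) =
  [set u : E | g_minf u /\ [set v : E | above 1 v] (derive1 (u : R -> R))].
Proof.
apply/seteqP; split => f /=; first by move=> cf; split; [case: cf|exact: chart_above].
by move=> [gf [_ f1]]; split.
Qed.

Lemma Phi_root phi w : (forall x, derive1 phi x = 1 + w x) ->
  Phi r phi = (fun x => root_seq r 0 (w x)).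
Proof. by move=> dphi; apply/funext => x; rewrite /Phi dphi root_seq0. Qed.

Lemma Phi_chart f : diff_chart f ->
  Phi r (fun x => x + f x) = (fun x => root_seq r 0 (derive1 f x)).
Proof. by move=> cf; apply: Phi_root => x; rewrite diff_derive1. Qed.

Lemma Phi_above f : diff_chart f -> above r (Phi r (fun x => x + f x)).
Proof.
move=> cf; rewrite Phi_chart//; have [sf f1] := chart_above cf; split.
  apply: (above_superposition ltr01 (root_seqP r)); last exact: chart_above.
  exact: power_seq00.
by move=> x; exact: root_seq_gt.
Qed.

Definition chart_inv w : R -> R := primitive (fun x => pow_seq r 0 (w x)).

Lemma smoothL1_pow w : above r w -> smoothL1 (fun x => pow_seq r 0 (w x)).
Proof.
by apply: (above_superposition r0 (pow_seqP r1)); exact: power_seq00.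
Qed.

Lemma chart_inv_derive1 w : above r w ->
  derive1 (chart_inv w) = (fun x => pow_seq r 0 (w x)).
Proof. by move=> aw; apply: derive1_primitive; exact: smoothL1_pow. Qed.

Lemma chart_inv_chart w : above r w -> diff_chart (chart_inv w).
Proof.
move=> aw; split; first by apply: primitive_g_minf; exact: smoothL1_pow.
by move=> x; rewrite chart_inv_derive1//; apply: pow_seq_gt => //; case: aw.
Qed.

Lemma chart_invK w : above r w -> Phi r (fun x => x + chart_inv w x) = w.
Proof.
move=> aw; rewrite Phi_chart; last exact: chart_inv_chart.
apply/funext => x; rewrite chart_inv_derive1// pow_seqK//; by case: aw.
Qed.

Lemma chart_PhiK f : diff_chart f -> chart_inv (Phi r (fun x => x + f x)) = f.
Proof.
move=> cf; have [gf f1] := cf; rewrite -[RHS]primitive_derive1// /chart_inv.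
by congr primitive; apply/funext => x; rewrite Phi_chart// root_seqK.
Qed.

Lemma Phi_invE w : Phi_inv r w = (fun x => x + chart_inv w x).
Proof.
apply/funext => x; congr (_ + _); apply: eq_Rintegral => t _.
by rewrite pow_seq0.
Qed.

Lemma image_Phi_chart : (fun f : E => (Phi r (fun y => y + f y) : E)) @` (@diff_chart R) =
  [set w : E | above r w].
Proof.
apply/seteqP; split => w /=; first by move=> [f cf <-]; exact: Phi_above.
move=> aw; exists (chart_inv w); [exact: chart_inv_chart|exact: chart_invK].
Qed.

Lemma Phi_open_embedding : frechet_open_embedding (@g_minf_frechet R) (@Winf1_frechet R)
  (@diff_chart R) (fun f x => Phi r (fun y => y + f y) x).
Proof.
split.
  have := frechet_smooth_derive1 (superposition_smooth ltr01 (root_seqP r)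
    (power_seq00 r 1 r^-1)).
  rewrite -diff_chartE; apply: eq_frechet_smooth => f cf.
  by rewrite (Phi_chart cf).
exists chart_inv; first exact: chart_PhiK.
rewrite image_Phi_chart.
exact: (frechet_smooth_primitive (superposition_smooth r0 (pow_seqP r1)
  (power_seq00 1 r^-1 r))).
Qed.

(** The weight is [(1 + f')^(1/r - 1) (1 + f') = (1 + f')^(1/r)]; its [r]-th power is the Jacobian
    of [id + f], so the integral is a change of variables. *)
Lemma Lnorm_root_diff f g : diff_chart f -> smoothL1 g ->
  Lr_norm r (fun x => root_seq r 1 (derive1 f x) * (g (x + f x) * (1 + derive1 f x))) =
  Lr_norm r g.
Proof.
move=> cf sg; have [_ f1] := cf; rewrite /Lr_norm unlock; congr (_ `^ _)%E.
have gE (u : R -> R) x : (`|(EFin \o u) x| `^ r)%E = (`|u x| `^ r)%:E.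
  by rewrite poweR_EFin.
under [RHS]eq_integral do rewrite gE.
rewrite (diff_change_of_variables cf (g := fun x => `|g x| `^ r)); first last.
- by move=> x; exact: powR_ge0.
- by apply: continuous_norm_powR => //; exact: smoothL1_continuous.
apply: eq_integral => x _; rewrite gE; congr EFin.
have p0 : 0 < 1 + derive1 f x by have := f1 x; lra.
rewrite root_seq1// !normrM (ger0_norm (ltW p0)) (ger0_norm (powR_ge0 _ _)).
rewrite mulrCA powRM ?mulr_ge0 ?powR_ge0 ?(ltW p0)//; congr (_ * _).
rewrite -[X in _ * X]powRr1 ?(ltW p0)// -powRD; last by rewrite (gt_eqF p0) implybT.
rewrite subrK -powRrM mulVf ?gt_eqF// powRr1// ltW//.
Qed.

(** Only the values along the two lines matter, which replaces the point [id + f] and direction [h]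
    by their counterparts [f'] and [h']. *)
Lemma eq_is_dirderive (W : frechetData E) (F G : E -> E) (u h u' h' v : E) :
  (forall t : R, F (u + t *: h) = G (u' + t *: h')) -> F u = G u' ->
  is_dirderive W G u' h' v -> is_dirderive W F u h v.
Proof.
move=> FG FG0 dG m; apply: cvg_trans (dG m); apply: near_eq_cvg.
by near=> t; rewrite FG FG0.
Unshelve. all: by end_near. Qed.

Lemma Phi_isometric : isometric r.
Proof.
move=> phi h [f cf ->] [X gX ->].
have [gf f1] := cf.
have [gh dh] := g_minf_diff cf gX.
set h' := X \o _.
have gh' : g_minf h' by exact: gh.
pose v := superposition_derive (root_seq r) (derive1 f) [:: (derive1 h' : E)].
have vE : v = (fun x => root_seq r 1 (derive1 f x) *
    (derive1 X (x + f x) * (1 + derive1 f x))).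
  apply/funext => x; rewrite /v /superposition_derive big_ord_recr big_ord0/= mul1r.
  by rewrite dh.
have sh' := g_minf_smoothL1 gh'.
have d0 : directions 0 ([::] : seq E) by split.
exists v; split.
- rewrite /v; apply/Winf1P.
  have d1 : directions 1 [:: (derive1 h' : E)] by split => // -[].
  by have [] := jointly_lipschitz_superposition_derive ltr01 (root_seqP r)
    (power_seq00 r 1 r^-1) (chart_above cf) d1.
- have E0 w : superposition_derive (root_seq r) w [::] = (fun x => root_seq r 0 (w x)).
    by apply/funext => x; rewrite /superposition_derive big_ord0 mulr1.
  apply: (eq_is_dirderive _ _ (superposition_derive_is_derive ltr01 (root_seqP r)
    (power_seq00 r 1 r^-1) (chart_above cf) sh' d0)) => [t|]; last first.
    by rewrite E0 Phi_chart.
  have Dt x := is_derive1D (diff_is_derive cf x) (is_derive1Z t (g_minf_is_derive x gh')).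
  (* The perturbed diffeomorphism has derivative [1 + (f' + t h')], so [Phi] along it is
     superposition along the line through [f']. *)
  transitivity (Phi r (fun x => (x + f x) + t * h' x)) => //.
  rewrite E0 (Phi_root (w := fun x => derive1 f x + t * derive1 h' x))//.
  by move=> x; rewrite (derive1_is_derive Dt) addrA.
(* What remains is the norm of the derivative of [X]; since the tangent vector is [X \o phi],
   composing it with the inverse of [phi] gives back [X]. *)
- rewrite vE Lnorm_root_diff//; last exact: g_minf_smoothL1.
  rewrite /finsler; congr Lr_norm; congr derive1.
  by apply/funext => y; rewrite /h' /= diff_pinvK.
Qed.

End Chart.

Theorem theorem2p2p1 (R : realType) (r : R) (hr : 1 <= r) :
  [/\ forall phi : R -> R, diff_minf phi -> Winf1 (Phi r phi),
      frechet_open_embedding g_minf_frechet Winf1_frechet diff_chart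
        (fun f x => Phi r (fun y => y + f y) x),
      isometric r,
      Phi r @` diff_minf = [set f : R -> R | Winf1 f /\ forall x, - r < f x]
    & (forall phi : R -> R, diff_minf phi -> Phi_inv r (Phi r phi) = phi) /\
      (forall f : R -> R, Winf1 f -> (forall x, - r < f x) ->
         diff_minf (Phi_inv r f) /\ Phi r (Phi_inv r f) = f)].
Proof.
have inv f : Winf1 f -> (forall x, - r < f x) ->
    diff_minf (Phi_inv r f) /\ Phi r (Phi_inv r f) = f.
  move=> /Winf1P sf rf; have af : above r f by [].
  rewrite Phi_invE chart_invK//; split => //.
  by exists (chart_inv r f) => //; exact: chart_inv_chart.
split.
- by move=> _ [f cf ->]; have [sf _] := Phi_above hr cf; exact/Winf1P.
- exact: Phi_open_embedding.
- exact: Phi_isometric.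
- apply/seteqP; split => w /=.
    by move=> [_ [f cf ->] <-]; have [sf rf] := Phi_above hr cf; split => //; exact/Winf1P.
  by move=> [Ww rw]; have [dw ew] := inv _ Ww rw; exists (Phi_inv r w).
- split=> // _ [f cf ->]; rewrite Phi_invE; apply/funext => x; congr (_ + _).
  by rewrite chart_PhiK.
Qed.
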